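(* Let $K>1$ and $\theta\in(-\pi/2,\pi/2]$, and let $\Psi:\mathbb{C}\setminus\mathcal{M}_{K,\theta}\to\mathbb{C}$ be the map $\Psi(c)=\psi_c(c)$. There exists $R=R(K,\theta)<\infty$ such that $\Psi$ is a quasiconformal homeomorphism of $\{c\in\mathbb{C}:|c|>R\}$ onto its image, with $\mathcal{H}(D_c\Psi)\le 1+O_{K,\theta}(|c|^{-1})$ (i.e. with implied constant depending only on $K$ and $\theta$) and $\det D_c\Psi>0$ on $\{|c|>R\}$, and $D_c\Psi\to I$ as $c\to\infty$.
   Context: Fix $K>1$ and $\theta\in(-\pi/2,\pi/2]$. Let $h=h_{K,\theta}:\mathbb{C}\to\mathbb{C}$, $h(z)=\frac{K+1}{2}z+e^{2i\theta}\frac{K-1}{2}\overline{z}$, be the real-linear stretch by factor $K$ in the direction $e^{i\theta}$. For $c\in\mathbb{C}$ let $f_c(z)=h(z)^2+c$ (so $f_0(z)=h(z)^2$), and let $f_c^n$ be the $n$-th iterate. Set $I(f_c)=\{z: f_c^n(z)\to\infty\}$, $BO(f_c)=\mathbb{C}\setminus I(f_c)$, and $\mathcal{M}_{K,\theta}=\{c\in\mathbb{C}:0\in BO(f_c)\}$. Böttcher coordinate $\psi_c$ (known, Fletcher–Fryer): near infinity put $\psi_0=\mathrm{id}$ and $\psi_{k+1}=f_0^{-1}\circ\psi_k\circ f_c$, the branch of $f_0^{-1}$ being chosen so that $\psi_{k+1}(z)=z+o(1)$ as $|z|\to\infty$. The sequence $(\psi_k)$ converges uniformly on a neighbourhood of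 infinity $U_c$ (which may be taken with $f_c(U_c)\subset U_c$ and $U_c\cup\{\infty\}$ simply connected) to a quasiconformal map $\psi_c$ with $\psi_c\circ f_c=f_0\circ\psi_c$ on $U_c$. If $c\notin\mathcal{M}_{K,\theta}$ and $n$ is the least integer with $c\in f_c^{-n}(U_c)$, then $\psi_c$ extends, by lifting curves under $f_c$ and $f_0$, to an injective continuous map on $f_c^{-n}(U_c)$ still satisfying $\psi_c\circ f_c=f_0\circ\psi_c$; this extension is uniquely determined by $\psi_c|_{U_c}$ and is again denoted $\psi_c$. Then $\Psi(c):=\psi_c(c)$ for $c\in\mathbb{C}\setminus\mathcal{M}_{K,\theta}$. $D_c$ denotes the real ($2\times2$) derivative with respect to $c$. For a real-linear map $A$ of the plane, $\|A\|=\max_{|z|=1}|A(z)|$, $\ell(A)=\min_{|z|=1}|A(z)|$ and $\mathcal{H}(A)=\|A\|/\ell(A)$. *)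

(* Defs.v *)
From HB Require Import structures.
From mathcomp Require Import all_boot all_order all_algebra.
From mathcomp Require Import all_classical all_reals all_analysis.
From mathcomp.real_closed Require Import complex.

Set Implicit Arguments.
Unset Strict Implicit.
Unset Printing Implicit Defensive.

Import Order.TTheory GRing.Theory Num.Theory.
Import numFieldNormedType.Exports.

Local Open Scope classical_set_scope.
Local Open Scope complex_scope.
Local Open Scope ring_scope.

(* The complex plane is [Rcomplex R]: the field R[i] seen as a vector space over
   R, with the R-valued modulus.  It becomes a normed space over R here, so that
   [differentiable], ['d f c] and ['D_v f] refer to real derivatives. *)
Section RcomplexNormedModule.
Variable R : realType.

HB.instance Definition _ :=
  PseudoMetric.copy (Rcomplex R) (pseudoMetric_normed (Rcomplex R)).

HB.instance Definition _ := isPointed.Build (Rcomplex R) 0.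

HB.instance Definition _ :=
  NormedZmod_PseudoMetric_eq.Build R (Rcomplex R) erefl.

Lemma Rcomplex_normrZ (l : R) (z : Rcomplex R) : `|l *: z| = `|l| * `|z|.
Proof.
case: z => x y; rewrite /Num.norm /= !exprMn -mulrDr sqrtrM ?sqr_ge0//.
by rewrite sqrtr_sqr.
Qed.

HB.instance Definition _ :=
  PseudoMetricNormedZmod_Lmodule_isNormedModule.Build R (Rcomplex R)
    Rcomplex_normrZ.

End RcomplexNormedModule.

Section Plane.
Variable R : realType.
Local Notation C := (Rcomplex R).

Definition ci : C := 0 +i* 1.

Definition cis (t : R) : C := cos t +i* sin t.

Definition exterior (r : R) : set C := [set z | r < `|z|].

Definition at_infinity : set_system C := filter_from [set: R] exterior.

Global Instance at_infinity_filter : ProperFilter at_infinity.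
Proof.
apply: filter_from_proper; last first.
  move=> r _; exists (((`|r| + 1) *: 1) : C); rewrite /exterior/=.
  have norm1 : `|1 : C| = 1 by exact: (@Normc.normc1 R).
  rewrite normrZ norm1 mulr1 ger0_norm ?addr_ge0//.
  by rewrite (le_lt_trans (ler_norm r))// ltrDl.
apply: filter_from_filter; first by exists 0.
move=> r s _ _; exists (Num.max r s) => // z.
by rewrite /exterior/= gt_max => /andP[].
Qed.

End Plane.

Arguments ci {R}.
Arguments at_infinity {R}.

Section RealLinearMaps.
Variable R : realType.
Local Notation C := (Rcomplex R).
Implicit Type A : C -> C.

(* The sup and the inf are attained when A is linear. *)
Definition opnorm A : R := sup [set `|A z| | z in [set z : C | `|z| = 1]].

Definition minnorm A : R := inf [set `|A z| | z in [set z : C | `|z| = 1]].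

Definition distortion A : R := opnorm A / minnorm A.

(* The determinant of the matrix of A in the basis (1, i). *)
Definition detR A : R :=
  complex.Re (A 1) * complex.Im (A ci) - complex.Re (A ci) * complex.Im (A 1).

End RealLinearMaps.

(* Quasiconformal maps of plane domains, in the analytic definition (Ahlfors,
   Lectures on Quasiconformal Mappings, Chapter II): a homeomorphism onto its
   image that is absolutely continuous on lines and satisfies
   |f_zbar| <= k |f_z| almost everywhere, for some k < 1. *)
Section Quasiconformal.
Variable R : realType.
Local Notation C := (Rcomplex R).
Local Notation mu := (@lebesgue_measure R).

Definition absolutely_continuous (a b : R) (g : R -> C) : Prop :=
  forall e : R, 0 < e -> exists2 d : R, 0 < d &
    forall (n : nat) (s t : 'I_n -> R),
      (forall i, [/\ a <= s i, s i <= t i & t i <= b]) ->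
      (forall i j, i != j -> t i <= s j \/ t j <= s i) ->
      \sum_(i < n) (t i - s i) < d ->
      \sum_(i < n) `|g (t i) - g (s i)| < e.

Definition ACL (U : set C) (f : C -> C) : Prop :=
  forall a b c d : R, a < b -> c < d ->
    (forall x y : R, a <= x <= b -> c <= y <= d -> U (x +i* y)) ->
    {ae mu, forall y, c <= y <= d ->
      absolutely_continuous a b (fun x => f (x +i* y))} /\
    {ae mu, forall x, a <= x <= b ->
      absolutely_continuous c d (fun y => f (x +i* y))}.

Definition dz (f : C -> C) (z : C) : C :=
  2^-1 *: ('D_1 f z - ci * 'D_ci f z).

Definition dzbar (f : C -> C) (z : C) : C :=
  2^-1 *: ('D_1 f z + ci * 'D_ci f z).

Definition homeomorphism_onto_image (U : set C) (f : C -> C) : Prop :=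
  {within U, continuous f} /\
  exists g : C -> C,
    {within f @` U, continuous g} /\ (forall z, U z -> g (f z) = z).

Definition quasiconformal (U : set C) (f : C -> C) : Prop :=
  [/\ homeomorphism_onto_image U f,
      ACL U f &
      exists2 k : R, 0 <= k < 1 &
        {ae (mu \x mu)%E, forall p : R * R, let z : C := p.1 +i* p.2 in
          U z -> [/\ derivable f z 1, derivable f z ci &
                     `|dzbar f z| <= k * `|dz f z|]}].

End Quasiconformal.

Section Dynamics.
Variable R : realType.
Local Notation C := (Rcomplex R).
Variables K theta : R.

Definition stretch (z : C) : C :=
  ((K + 1) / 2) *: z + ((K - 1) / 2) *: (cis (2 * theta) * (conjc z : C)).

Definition qmap (c z : C) : C := stretch z ^+ 2 + c.

Definition escaping (c : C) : set C :=
  [set z | (fun n => iter n (qmap c) z) @ \oo --> at_infinity].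

Definition BO (c : C) : set C := ~` escaping c.

Definition Mset : set C := [set c | BO c 0].

(* The equation f_0 (psi_(k+1) z) = psi_k (f_c z) says that psi_(k+1) is a
   branch of f_0^-1 o psi_k o f_c; the last condition selects the branch. *)
Definition bottcher_sequence (c : C) (U : set C) (psi_ : nat -> C -> C) :=
  [/\ forall z, U z -> psi_ 0%N z = z,
      forall k, {within U, continuous (psi_ k)},
      forall k z, U z -> qmap 0 (psi_ k.+1 z) = psi_ k (qmap c z) &
      forall k, psi_ k.+1 z - z @[z --> at_infinity] --> (0 : C)].

(* The neighbourhood U_c of infinity is taken to be the exterior of a closed
   disc centred at 0; together with the point at infinity it is an open disc of
   the sphere, hence simply connected. *)
Definition bottcher_coordinate (c : C) (r : R) (psi : C -> C) : Prop :=
  [/\ 0 < r,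
      qmap c @` exterior r `<=` exterior r &
      exists psi_ : nat -> C -> C,
        bottcher_sequence c (exterior r) psi_ /\
        {uniform exterior r, psi_ @ \oo --> psi}].

Definition bottcher_extension (c : C) (r : R) (n : nat) (psi : C -> C) :=
  let V := iter n (qmap c) @^-1` exterior r in
  [/\ bottcher_coordinate c r psi,
      V c /\ (forall m, exterior r (iter m (qmap c) c) -> (n <= m)%N),
      {within V, continuous psi},
      {in V &, injective psi} &
      forall z, V z -> psi (qmap c z) = qmap 0 (psi z)].

(* The value psi_c(c); it is only meaningful for c outside of Mset. *)
Definition Psi (c : C) : C :=
  xget 0 [set w | exists r n psi, bottcher_extension c r n psi /\ w = psi c].

End Dynamics.

(* Main.v *)
Require Import Defs.
From HB Require Import structures.
From mathcomp Require Import all_boot all_order all_algebra.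
From mathcomp Require Import all_classical all_reals all_analysis.
From mathcomp Require Import ring lra.
From mathcomp.real_closed Require Import complex.

Set Implicit Arguments.
Unset Strict Implicit.
Unset Printing Implicit Defensive.

Import Order.TTheory GRing.Theory Num.Theory.
Import numFieldNormedType.Exports.

Local Open Scope classical_set_scope.
Local Open Scope ring_scope.

(* Write h for the stretch, so that |z| <= |h z| <= K |z|.  Where |z| is large
   and |c| = O(|z|), the branch of f_0^-1 is the one with h(psi_(k+1) z) near
   h z, and the factorisation a^2 - b^2 = (a - b)(a + b) applied to
   h(psi_(k+1) z)^2 = psi_k(f_c z) shows that f_0^-1 contracts by |z|^-1.  Hence
   psi_k converges geometrically on |z| > |c|/N, a set that contains z = c, and
   psi_c(c) = c + O(1).

   Any other choice of U_c and n gives the same psi_c(c).  The two functions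
   agree near infinity, and agreement at f_c(z) implies agreement up to sign at
   z; if the sign were wrong somewhere, then |f_c^j| would have a maximum on the
   compact set of points with the wrong sign, although f_c^j is an open map.

   For the derivative in c, let dz_j and du_j be the derivatives of the orbit
   z_j = f_c^j(c) and of its successive preimages u_j under f_0.  The error
   e_j = du_j - dz_j satisfies
     2 h(u_j) h(e_j) = e_(j+1) + I + 2 (h(z_j) - h(u_j)) h(dz_j).
   Since h(z_j) - h(u_j) is bounded and dz_j / z_j grows only geometrically,
   e_0 = O(1/|c|), and the same recursion applied to the difference of two
   approximations gives geometric convergence of the derivatives.  So Psi is the
   identity plus a map whose derivative is O(1/|c|). *)

(* The ascription to Rcomplex keeps the ring operations inside the norm from
   being read in R[i], whose norm is not real-valued. *)
Local Notation "|[ x ]|" := (`|x : Rcomplex _|)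
  (at level 0, x at level 99, only parsing).

(** * Moduli and square roots in the plane *)

Section Plane.
Variable R : realType.
Local Notation C := (Rcomplex R).
Implicit Types x y z w : C.

Lemma RnormM x y : |[x * y]| = |[x]| * |[y]|.
Proof. exact: (@ComplexField.Normc.normcM R). Qed.

Lemma RnormX x n : |[x ^+ n]| = |[x]| ^+ n.
Proof.
elim: n => [|n IH]; first by rewrite !expr0; exact: (@ComplexField.Normc.normc1 R).
by rewrite !exprS RnormM IH.
Qed.

Lemma RnormV x : |[x^-1]| = |[x]|^-1.
Proof. exact: (@ComplexField.Normc.normcV R). Qed.

Lemma Rnorm1 : |[1 : C]| = 1.
Proof. exact: (@ComplexField.Normc.normc1 R). Qed.

Lemma Rnorm_ci : |[ci : C]| = 1.
Proof.
by rewrite /Num.norm /= expr0n /= expr1n add0r sqrtr1.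
Qed.

Lemma Rnorm_cis t : |[cis t : C]| = 1.
Proof. by rewrite /Num.norm /= cos2Dsin2 sqrtr1. Qed.

Lemma Rnorm_conj z : |[conjc z]| = |[z]|.
Proof. by case: z => a b; rewrite /Num.norm /= sqrrN. Qed.

Lemma Re_le_Rnorm z : `|complex.Re z| <= |[z]|.
Proof.
case: z => a b; rewrite /= [leRHS]/Num.norm /= -[leLHS]sqrtr_sqr ler_sqrt.
  by rewrite lerDl sqr_ge0.
by rewrite addr_ge0// sqr_ge0.
Qed.

Lemma Im_le_Rnorm z : `|complex.Im z| <= |[z]|.
Proof.
case: z => a b; rewrite /= [leRHS]/Num.norm /= -[leLHS]sqrtr_sqr ler_sqrt.
  by rewrite lerDr sqr_ge0.
by rewrite addr_ge0// sqr_ge0.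
Qed.

Lemma Rnorm_le_ReIm z : |[z]| <= `|complex.Re z| + `|complex.Im z|.
Proof.
case: z => a b; rewrite /= [leLHS]/Num.norm /=.
rewrite -[leRHS]ger0_norm ?addr_ge0// -[leRHS]sqrtr_sqr ler_sqrt ?sqr_ge0//.
by rewrite sqrrD !real_normK ?num_real// addrAC lerDl mulrn_wge0// mulr_ge0.
Qed.

Lemma ReDIm z : z = complex.Re z *: (1 : C) + complex.Im z *: ci.
Proof.
case: z => a b; rewrite /ci /=; apply/eqP; rewrite eq_complex /=.
by rewrite !mulr1 !mulr0 add0r addr0 !eqxx.
Qed.

Definition csqrt z : C := (sqrtc z : C).

Lemma csqrtK z : csqrt z ^+ 2 = z.
Proof. exact: (@sqr_sqrtc R). Qed.

Lemma Re_csqrt_ge0 z : 0 <= complex.Re (csqrt z).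
Proof. by case: z => a b; rewrite /csqrt /= sqrtr_ge0. Qed.

(** The principal root has nonnegative real part, so its sum with 1 has modulus at least 1 in the
    factorisation of [z - 1]. Thus the principal root of a number near 1 is the root near 1. *)
Lemma csqrt_sub1 z : |[csqrt z - 1]| <= |[z - 1]|.
Proof.
have -> : z - 1 = (csqrt z - 1) * (csqrt z + 1) by rewrite -subr_sqr csqrtK expr1n.
rewrite RnormM ler_peMr//.
apply: le_trans (Re_le_Rnorm _).
apply: le_trans (ler_norm _); rewrite raddfD /= lerDr; exact: Re_csqrt_ge0.
Qed.

(** Choose the sign of the root so that |s - w| <= |s + w|; the product of these two factors is |u -
    w^2|. *)
Lemma near_sqrt w u : exists2 s : C, s ^+ 2 = u & |[s - w]| ^+ 2 <= |[u - w ^+ 2]|.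
Proof.
pose s := csqrt u.
have E : |[u - w ^+ 2]| = |[s - w]| * |[s + w]|.
  by rewrite -RnormM -subr_sqr csqrtK.
case: (leP |[s - w]| |[s + w]|) => H.
- by exists s; [rewrite csqrtK | rewrite E expr2 ler_wpM2l].
- exists (- s); first by rewrite sqrrN csqrtK.
  by rewrite E -opprD normrN expr2 ler_wpM2r// ltW.
Qed.

End Plane.

(** * The stretch and the quadratic map *)

Section Stretch.
Variables (R : realType) (K theta : R).
Hypothesis K_gt1 : 1 < K.
Local Notation C := (Rcomplex R).
Local Notation h := (stretch K theta).
Local Notation f := (qmap K theta).
Implicit Types c z w x y : C.

(** With |e| = 1, the map a z + b e conj(z) has determinant a^2 - b^2, which is K here, and its
    inverse is the same map with b replaced by -b, divided by K. *)
Definition stretch_inv w : C :=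
  K^-1 *: (((K + 1) / 2) *: w - ((K - 1) / 2) *: (cis (2 * theta) * (conjc w : C))).

Lemma stretch_linear : linear h.
Proof.
move=> a [u1 u2] [v1 v2]; rewrite /stretch; case: (cis _) => e1 e2.
by apply/eqP; rewrite eq_complex /=; apply/andP; split; apply/eqP; ring.
Qed.

HB.instance Definition _ := GRing.isLinear.Build R C C _ h stretch_linear.

Lemma stretch_invK : cancel stretch_inv h.
Proof.
have K0 : K != 0 by rewrite lt0r_neq0// (lt_trans ltr01).
move=> [w1 w2]; rewrite /stretch /stretch_inv /cis.
have := cos2Dsin2 (2 * theta).
move: (cos _) (sin _) => e1 e2 E.
have E2 : e2 ^+ 2 = 1 - e1 ^+ 2 by rewrite -E addrAC subrr add0r.
apply/eqP; rewrite eq_complex /=; apply/andP; split; apply/eqP; field: E2 => //.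
Qed.

Lemma stretch_le z : |[h z]| <= K * |[z]|.
Proof.
have K1 := K_gt1.
apply: le_trans (ler_normD _ _) _.
rewrite !normrZ RnormM Rnorm_cis Rnorm_conj mul1r !ger0_norm; lra.
Qed.

Lemma stretch_ge z : |[z]| <= |[h z]|.
Proof.
have K1 := K_gt1.
apply: le_trans (lerB_normD _ _).
rewrite !normrZ RnormM Rnorm_cis Rnorm_conj mul1r !ger0_norm; lra.
Qed.

Lemma stretch_le_dist x y : |[h x - h y]| <= K * |[x - y]|.
Proof. by rewrite -[in leLHS]linearB; apply: stretch_le. Qed.

Lemma stretch_ge_dist x y : |[x - y]| <= |[h x - h y]|.
Proof. by rewrite -[in leRHS]linearB; apply: stretch_ge. Qed.

Lemma stretch_inj : injective h.
Proof.
move=> x y /eqP; rewrite -subr_eq0 -raddfB => /eqP E.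
apply/eqP; rewrite -subr_eq0 -normr_le0 (le_trans (stretch_ge _))// E normr0//.
Qed.

Lemma stretchZ (t : R) z : h (t *: z) = t *: h z.
Proof. exact: linearZ. Qed.

Lemma stretchD x y : h (x + y) = h x + h y.
Proof. exact: linearD. Qed.

Lemma stretchB x y : h (x - y) = h x - h y.
Proof. exact: linearB. Qed.

Lemma qmapE c z : f c z = h z ^+ 2 + c.
Proof. by []. Qed.

Lemma qmap_ge c z : |[z]| ^+ 2 - |[c]| <= |[f c z]|.
Proof.
rewrite qmapE; apply: le_trans (lerB_normD _ _).
by rewrite RnormX lerB// lerXn2r ?nnegrE// stretch_ge.
Qed.

Lemma qmap_le c z : |[f c z]| <= K ^+ 2 * |[z]| ^+ 2 + |[c]|.
Proof.
rewrite qmapE; apply: le_trans (ler_normD _ _) _.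
rewrite RnormX lerD2r -exprMn lerXn2r ?nnegrE ?stretch_le//.
by rewrite mulr_ge0// ltW// (lt_trans ltr01).
Qed.

(** Quantitative openness, valid also at the critical point: the image of the disc of radius r about
    z contains the disc of radius r^2 about f_c(z). *)
Lemma qmap_open c z w : exists2 y, f c y = w & |[y - z]| ^+ 2 <= |[w - f c z]|.
Proof.
have [s sE ns] := near_sqrt (h z) (w - c).
exists (stretch_inv s); first by rewrite qmapE stretch_invK sE subrK.
have -> : w - f c z = w - c - h z ^+ 2 by rewrite qmapE opprD addrA addrAC.
apply: le_trans ns; rewrite lerXn2r ?nnegrE//.
by apply: le_trans (stretch_ge _) _; rewrite linearB/= stretch_invK.
Qed.

End Stretch.

(** * Convergence to the Bottcher coordinate *)

Section GeometricLimits.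
Variable R : realType.
Local Notation C := (Rcomplex R).

(** The intervals with centre u_k and radius 2A/2^k, the sum of the remaining increments, are
    nested; the limit is the supremum of their left ends. *)
Lemma geometric_limit (u : nat -> R) (A : R) :
    (forall k, `|u k.+1 - u k| <= A / 2 ^+ k) ->
  exists l, forall k, `|u k - l| <= 2 * A / 2 ^+ k.
Proof.
move=> uA; pose e k := 2 * A / 2 ^+ k.
have eS k : A / 2 ^+ k = e k - e k.+1.
  by rewrite /e exprS; field; rewrite expf_neq0.
have a_nd : {homo (fun k => u k - e k) : m n / (m <= n)%N >-> m <= n}.
  apply: homo_leq => // [m n p|k]; first exact: le_trans.
  have := uA k; rewrite eS ler_norml => /andP[+ _]; lra.
have b_ni : {homo (fun k => - (u k + e k)) : m n / (m <= n)%N >-> m <= n}.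
  apply: homo_leq => // [m n p|k]; first exact: le_trans.
  have := uA k; rewrite eS ler_norml => /andP[_ +]; lra.
have e_ge0 k : 0 <= e k.
  have : 0 <= A by have := uA 0%N; rewrite expr0 divr1; apply: le_trans.
  by move=> A0; rewrite /e !mulr_ge0// invr_ge0 exprn_ge0.
have ab m n : u m - e m <= u n + e n.
  have := a_nd _ _ (leq_maxl m n); have := b_ni _ _ (leq_maxr m n).
  have := e_ge0 (maxn m n); lra.
exists (sup (range (fun k => u k - e k))) => k.
have ubk n : ubound (range (fun k => u k - e k)) (u n + e n).
  by move=> _ [m _ <-].
have h1 : u k - e k <= sup (range (fun k => u k - e k)).
  by apply: ub_le_sup; [exists (u k + e k); apply: ubk | exists k].
have h2 : sup (range (fun k => u k - e k)) <= u k + e k.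
  by apply: ge_sup; [exists (u 0%N - e 0%N), 0%N | apply: ubk].
by rewrite -/(e k) ler_norml; apply/andP; split; lra.
Qed.

Lemma Rcomplex_geometric_limit (u : nat -> C) (A : R) :
    (forall k, |[u k.+1 - u k]| <= A / 2 ^+ k) ->
  exists l : C, forall k, |[u k - l]| <= 4 * A / 2 ^+ k.
Proof.
move=> uA.
have [k|a aE] := @geometric_limit (fun k => complex.Re (u k)) A.
  by rewrite -raddfB; apply: le_trans (uA k); apply: Re_le_Rnorm.
have [k|b bE] := @geometric_limit (fun k => complex.Im (u k)) A.
  by rewrite -raddfB; apply: le_trans (uA k); apply: Im_le_Rnorm.
exists (Complex a b) => k; apply: le_trans (Rnorm_le_ReIm _) _.
rewrite !raddfB /=; have := lerD (aE k) (bE k); move/le_trans; apply.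
by rewrite -!mulrA -mulrDl (_ : 2 + 2 = 4)//; ring.
Qed.

Lemma expr_half_small (A e : R) : 0 < e -> exists k, A / 2 ^+ k < e.
Proof.
move=> e0.
have [A0|A0] := leP A 0.
  by exists 0%N; rewrite expr0 divr1 (le_lt_trans A0).
have := archi_boundP (ltW (divr_gt0 A0 e0)).
set n := Num.bound _ => An; exists n.
rewrite ltr_pdivrMr ?exprn_gt0// mulrC -ltr_pdivrMr//.
apply: lt_le_trans An _.
by rewrite -natrX ler_nat ltnW// ltn_expl.
Qed.

End GeometricLimits.

(** * The approximations psi_k and their rate of convergence *)

Section Bottcher.
Variables (R : realType) (K theta : R).
Hypothesis K_gt1 : 1 < K.
Local Notation C := (Rcomplex R).
Local Notation h := (stretch K theta).
Local Notation f := (qmap K theta).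
Implicit Types c z w x y : C.

(* For |c| >= N * Q the set U_c is taken to be |z| > |c| / N, where regime holds. *)
Definition cstN : R := 4 * (K ^+ 2 + 1).
Definition cstQ : R := 32 * cstN * K ^+ 3.
Local Notation N := cstN.
Local Notation Q := cstQ.

(** The domain of all estimates below. It is forward invariant under f_c, where |z| at least
    doubles, and it contains z = c once |c| is large. *)
Definition regime c z := |[c]| < N * |[z]| /\ Q < |[z]|.

Lemma cstN_gt8 : 8 < N.
Proof. have K1 := K_gt1; rewrite /cstN; nra. Qed.

Lemma cstQ_gt : [/\ 4 * N + 1 <= Q, 16 * K ^+ 2 <= Q & 32 * N * K ^+ 3 <= Q].
Proof.
have K1 := K_gt1; have N8 := cstN_gt8; rewrite /cstQ.
have K2 : 1 < K ^+ 2 by rewrite expr2; nra.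
have K3 : K ^+ 2 < K ^+ 3 by rewrite [ltRHS]exprS; nra.
split=> //.
- have : N < N * K ^+ 3 by nra.
  nra.
- have : 8 * K ^+ 2 <= N * K ^+ 3 by nra.
  rewrite -mulrA; nra.
Qed.

Lemma cstQ_gt8 : 8 < Q.
Proof. by have [Q1 _ _] := cstQ_gt; have N8 := cstN_gt8; lra. Qed.

Lemma qmap_regime_ge c z : regime c z -> |[z]| ^+ 2 / 2 <= |[f c z]|.
Proof.
move=> [cz zQ]; have [Q1 _ _] := cstQ_gt; have N8 := cstN_gt8.
apply: le_trans (qmap_ge theta K_gt1 c z).
have : 2 * N * |[z]| <= |[z]| * |[z]| by apply: ler_wpM2r => //; lra.
rewrite expr2; lra.
Qed.

Lemma qmap_regime_ge2 c z : regime c z -> 2 * |[z]| <= |[f c z]|.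
Proof.
move=> cz; apply: le_trans (qmap_regime_ge cz).
case: cz => _ zQ; have Q8 := cstQ_gt8; nra.
Qed.

Lemma regime_qmap c z : regime c z -> regime c (f c z).
Proof.
move=> cz; have := qmap_regime_ge2 cz; case: cz => cz zQ z2.
have N8 := cstN_gt8; have Q8 := cstQ_gt8; split; last by lra.
apply: lt_le_trans cz _; rewrite ler_pM2l; lra.
Qed.

Lemma regime_neq0 c z : regime c z -> h z != 0.
Proof.
move=> [_ zQ]; have Q8 := cstQ_gt8; rewrite -normr_gt0.
have := stretch_ge theta K_gt1 z; lra.
Qed.

(** Under [regime] the quotient below the root is close to 1, so the principal root selects the
    branch of f_0^-1 that stays near z. *)
Fixpoint psik (k : nat) c z : C :=
  if k is k'.+1
  then stretch_inv K theta (h z * csqrt (psik k' c (f c z) / h z ^+ 2)) else z.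

(** By induction the error at f_c(z) is at most |c|. With the shift by c, the quotient below the
    root is within 2|c| / |h z|^2 of 1, and multiplying its root by h z restores the bound. *)
Lemma psik_near k c z : regime c z -> |[h (psik k c z) - h z]| <= 2 * |[c]| / |[z]|.
Proof.
elim: k z => [|k IH] z cz /=; first by rewrite subrr normr0 divr_ge0// mulr_ge0.
have Q8 := cstQ_gt8; have zQ := cz.2.
have hz0 := regime_neq0 cz.
have hz : |[z]| <= |[h z]| by apply: stretch_ge.
rewrite stretch_invK// -[X in _ - X]mulr1 -mulrBr RnormM.
have d : |[psik k c (f c z) - f c z]| <= |[c]|.
  apply: (@le_trans _ _ |[h (psik k c (f c z)) - h (f c z)]|).
    exact: stretch_ge_dist.
  apply: le_trans (IH _ (regime_qmap cz)) _.
  have f2 := qmap_regime_ge2 cz; rewrite ler_pdivrMr; last by lra.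
  by rewrite mulrC; apply: ler_wpM2l => //; lra.
have := csqrt_sub1 (psik k c (f c z) / h z ^+ 2).
have -> : psik k c (f c z) / h z ^+ 2 - 1
    = (psik k c (f c z) - f c z + c) / h z ^+ 2.
  apply: (mulIf (expf_neq0 2 hz0)); rewrite mulrBl !divfK ?expf_neq0// mul1r.
  by rewrite [in RHS]qmapE; ring.
rewrite RnormM RnormV RnormX => csqrtB.
have hz_gt0 : 0 < |[h z]| by lra.
apply: (@le_trans _ _ (|[h z]| * ((|[c]| + |[c]|) / |[h z]| ^+ 2))).
  apply: ler_wpM2l => //; apply: le_trans csqrtB _.
  rewrite ler_pM2r ?invr_gt0 ?exprn_gt0//; apply: le_trans (ler_normD _ _) _.
  by rewrite lerD2r.
have -> : |[h z]| * ((|[c]| + |[c]|) / |[h z]| ^+ 2) = 2 * |[c]| / |[h z]|.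
  by field; rewrite lt0r_neq0.
rewrite ler_wpM2l ?mulr_ge0// lef_pV2// posrE; lra.
Qed.

Lemma regime_ratio c z : regime c z -> 2 * |[c]| / |[z]| <= 2 * N.
Proof.
move=> [cz zQ]; have Q8 := cstQ_gt8; rewrite ler_pdivrMr; lra.
Qed.

Lemma psik_bound k c z : regime c z -> |[h (psik k c z) - h z]| <= 2 * N.
Proof. by move=> cz; apply: le_trans (psik_near k cz) (regime_ratio cz). Qed.

Lemma psik_sq k c z : regime c z -> h (psik k.+1 c z) ^+ 2 = psik k c (f c z).
Proof.
move=> /regime_neq0 hz0 /=; rewrite stretch_invK// exprMn csqrtK mulrC divfK//.
by rewrite expf_neq0.
Qed.

(** The lower bound for the factor a + b in a^2 - b^2: the sum is near 2 h z, and Q >= 4N + 1 pays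
    for the deviation. The slack 1 lets y come from a point near z. *)
Lemma near_sum_ge c z x y : regime c z -> |[x - h z]| <= 2 * N ->
  |[y - h z]| <= 2 * N + 1 -> |[z]| <= |[x + y]|.
Proof.
move=> [_ zQ] xz yz; have [Q1 _ _] := cstQ_gt.
have hz : |[z]| <= |[h z]| by apply: stretch_ge.
have : |[h z + h z]| = |[h z]| + |[h z]|.
  by rewrite -mulr2n normrMn mulr2n.
have -> : h z + h z = x + y - (x - h z) - (y - h z) by ring.
have := ler_normB (x + y - (x - h z)) (y - h z).
have := ler_normB (x + y) (x - h z).
lra.
Qed.

Lemma sqr_subM x y : |[x - y]| * |[x + y]| = |[x ^+ 2 - y ^+ 2]|.
Proof. by rewrite -RnormM -subr_sqr. Qed.

(** The difference of the squares is the preceding difference taken at f_c(z). Dividing by the sum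
    gains a factor |z|, of which only 2 is kept. *)
Lemma psik_step k c z : regime c z ->
  |[h (psik k.+1 c z) - h (psik k c z)]| <= 2 * N / 2 ^+ k.
Proof.
elim: k z => [|k IH] z cz; first by rewrite expr0 divr1; apply: psik_bound.
have N8 := cstN_gt8; have Q8 := cstQ_gt8; have zQ := cz.2.
have := sqr_subM (h (psik k.+2 c z)) (h (psik k.+1 c z)).
have yz : |[h (psik k.+1 c z) - h z]| <= 2 * N + 1.
  by apply: le_trans (psik_bound _ cz) _; rewrite lerDl.
have := near_sum_ge cz (psik_bound k.+2 cz) yz.
set a := |[_ + _]|; set b := |[_ - _]|; rewrite !psik_sq// => za ab.
have : b * a <= 2 * N / 2 ^+ k.
  rewrite ab; apply: le_trans (IH _ (regime_qmap cz)).
  exact: stretch_ge_dist.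
have -> : 2 * N / 2 ^+ k.+1 = 2 * N / 2 ^+ k / 2 by rewrite exprS; field; rewrite expf_neq0.
have b0 : 0 <= b by exact: normr_ge0.
nra.
Qed.

End Bottcher.

Arguments psik {R} K theta k c z : simpl never.

(** * Continuity, uniform convergence and compactness in terms of the modulus *)

Section Topology.
Variable R : realType.
Local Notation C := (Rcomplex R).
Implicit Types (z w : C) (g : C -> C).

Lemma near_lt_norm z (d : R) : 0 < d -> \forall w \near z, |[w - z]| < d.
Proof.
move=> d0; have /cvgrPdist_lt/(_ d d0) := @cvg_id _ (nbhs z).
by apply: filterS => w; rewrite distrC.
Qed.

Lemma near_norm_ball z (P : set C) : (\forall w \near z, P w) ->
  exists2 d : R, 0 < d & forall w, |[w - z]| < d -> P w.
Proof.
move=> zP; have /nbhs_ballP[d /= d0 dP] : nbhs z P by [].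
by exists d => // w wd; apply: dP; rewrite -ball_normE /= distrC.
Qed.

Lemma continuous_distP g z :
  {for z, continuous g} <-> forall e : R, 0 < e -> \forall w \near z, |[g w - g z]| < e.
Proof.
have P := @cvgrPdist_lt R C C (nbhs z) _ g (g z).
split=> [/P H e e0|H]; last apply/P => e e0.
  by apply: filterS (H e e0) => w; rewrite distrC.
by apply: filterS (H e e0) => w; rewrite distrC.
Qed.

Lemma lipschitz_continuous_at g z (M : R) :
  (\forall w \near z, |[g w - g z]| <= M * |[w - z]|) -> {for z, continuous g}.
Proof.
move=> gM; apply/continuous_distP => e e0.
have M0 : 0 < `|M| + 1 by rewrite ltr_wpDl.
near=> w; have wz : |[w - z]| < e / (`|M| + 1) by near: w; apply/near_lt_norm/divr_gt0.
have /le_lt_trans : |[g w - g z]| <= M * |[w - z]| by near: w.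
apply; move: wz; rewrite ltr_pdivlMr// mulrC; apply: le_lt_trans.
apply: ler_wpM2r => //; have := ler_norm M; lra.
Unshelve. all: by end_near. Qed.

Lemma uniform_cvg_distP (U : set C) (u : nat -> C -> C) g :
  {uniform U, u @ \oo --> g} <->
  forall e : R, 0 < e -> \forall n \near \oo, forall y, U y -> |[g y - u n y]| < e.
Proof.
split=> [H e e0|H P /uniform_nbhs[E []]].
- have := H [set k | forall y, U y -> |[g y - k y]| < e]; apply.
  apply/uniform_nbhs; exists [set p : C * C | ball p.1 e p.2]; split.
    exact: entourage_ball (PosNum e0).
  by move=> k /= Hk y Uy; have := Hk y Uy; rewrite -ball_normE.
- rewrite -entourage_ballE => -[e /= e0 eE] EP.
  apply: filterS (H e e0) => n Hn; apply: EP => y Uy /=; apply: eE => /=.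
  by rewrite -ball_normE; apply: Hn.
Qed.

Lemma Rcomplex_compact (A : set C) (M : R) :
  closed A -> (forall z, A z -> |[z]| <= M) -> compact A.
Proof.
move=> cA AM.
pose mk (p : R * R) : C := Complex p.1 p.2.
have mkc : continuous mk.
  move=> p; apply/cvgrPdist_lt => e e0.
  have e2 : 0 < e / 2 by rewrite divr_gt0.
  have p1 : \forall t \near nbhs p, `|p.1 - t.1| < e / 2.
    exact: (@cvgrPdist_lt R R (R * R)%type (nbhs p) _ fst p.1).1 cvg_fst _ e2.
  have p2 : \forall t \near nbhs p, `|p.2 - t.2| < e / 2.
    exact: (@cvgrPdist_lt R R (R * R)%type (nbhs p) _ snd p.2).1 cvg_snd _ e2.
  near=> q.
  apply: le_lt_trans (Rnorm_le_ReIm _) _; rewrite !raddfB /=.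
  by rewrite [ltRHS](splitr e) ltrD//; near: q.
have cK : compact (mk @` (`[- M, M] `*` `[- M, M])).
  apply: continuous_compact; first exact: continuous_subspaceT.
  by apply: compact_setX; apply: segment_compact.
apply: (subclosed_compact cA cK) => z Az.
exists (complex.Re z, complex.Im z); last by case: z {Az}.
split; rewrite /= in_itv /= -ler_norml; apply: le_trans (AM z Az).
  exact: Re_le_Rnorm.
exact: Im_le_Rnorm.
Unshelve. all: by end_near. Qed.

Lemma le_half_eq0 (x A : R) : (forall k, x <= A / 2 ^+ k) -> x <= 0.
Proof.
move=> xA; rewrite leNgt; apply/negP => /(expr_half_small A)[k].
by rewrite ltNge xA.
Qed.

End Topology.

(** * The Bottcher coordinate outside a disc *)

Section Extension.
Variables (R : realType) (K theta : R).
Hypothesis K_gt1 : 1 < K.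
Local Notation C := (Rcomplex R).
Local Notation h := (stretch K theta).
Local Notation f := (qmap K theta).
Local Notation N := (cstN K).
Local Notation Q := (cstQ K).
Local Notation psik := (psik K theta).
Local Notation regime := (regime K).
Implicit Types c z w x y : C.

(** The pointwise limit of [psik], specified by its rate of convergence so that uniform estimates
    are immediate; the value is 0 where there is no such limit. *)
Definition bottcher c z : C :=
  xget 0 [set l : C | forall k, |[psik k c z - l]| <= 8 * N / 2 ^+ k].

Lemma bottcher_lim k c z : regime c z -> |[psik k c z - bottcher c z]| <= 8 * N / 2 ^+ k.
Proof.
move=> cz; have [k'|l Hl] := @Rcomplex_geometric_limit R (fun k => psik k c z) (2 * N).
  by apply: le_trans _ (psik_step theta K_gt1 k' cz); exact: stretch_ge_dist.
apply: (@xgetPex _ 0 [set l : C | forall k, |[psik k c z - l]| <= 8 * N / 2 ^+ k]).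
by exists l => k'; apply: le_trans (Hl k') _; rewrite mulrA -natrM.
Qed.

Lemma stretch_bottcher_lim k c z : regime c z ->
  |[h (psik k c z) - h (bottcher c z)]| <= 8 * N * K / 2 ^+ k.
Proof.
move=> cz; apply: le_trans (stretch_le_dist theta K_gt1 _ _) _.
have K1 := K_gt1; have := bottcher_lim k cz.
have -> : 8 * N * K / 2 ^+ k = K * (8 * N / 2 ^+ k) by ring.
rewrite ler_pM2l//; lra.
Qed.

Lemma bottcher_near c z : regime c z -> |[h (bottcher c z) - h z]| <= 2 * |[c]| / |[z]|.
Proof.
move=> cz; rewrite -subr_le0; apply: (@le_half_eq0 _ _ (8 * N * K)) => k.
have := stretch_bottcher_lim k cz; have := psik_near theta K_gt1 k cz.
have := ler_distD (h (psik k c z)) (h (bottcher c z)) (h z).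
rewrite [|[h (bottcher c z) - h (psik k c z)]|]distrC; lra.
Qed.

Lemma bottcher_bound c z : regime c z -> |[h (bottcher c z) - h z]| <= 2 * N.
Proof. by move=> cz; apply: le_trans (bottcher_near cz) (regime_ratio K_gt1 cz). Qed.

(** The relation [psik_sq] in the limit: its two sides approximate these two with errors O(2^-k). *)
Lemma bottcher_sq c z : regime c z -> h (bottcher c z) ^+ 2 = bottcher c (f c z).
Proof.
move=> cz; apply/eqP; rewrite -subr_eq0 -normr_le0.
set B := bottcher c z.
apply: (@le_half_eq0 _ _ (8 * N * K * (2 * |[h B]| + 8 * N * K) + 8 * N)) => k.
have H1 := bottcher_lim k (regime_qmap theta K_gt1 cz).
have H2 := stretch_bottcher_lim k.+1 cz.
have NK0 : 0 <= 8 * N * K.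
  by have N8 := cstN_gt8 K_gt1; have K1 := K_gt1; apply: mulr_ge0; lra.
have H3 : 8 * N * K / 2 ^+ k.+1 <= 8 * N * K / 2 ^+ k.
  by rewrite ler_wpM2l// lef_pV2 ?posrE ?exprn_gt0// ler_eXn2l ?ltr1n.
have H4 : 8 * N * K / 2 ^+ k.+1 <= 8 * N * K.
  by rewrite ler_pdivrMr ?exprn_gt0// ler_peMr// exprn_ege1// ler1n.
have -> : h B ^+ 2 - bottcher c (f c z) =
   (h B ^+ 2 - h (psik k.+1 c z) ^+ 2) + (psik k c (f c z) - bottcher c (f c z)).
  by rewrite psik_sq//; ring.
apply: le_trans (ler_normD _ _) _; rewrite mulrDl; apply: lerD => //.
rewrite -sqr_subM distrC mulrAC; apply: ler_pM => //.
  exact: le_trans H3.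
have -> : h B + h (psik k.+1 c z) = h B + h B + (h (psik k.+1 c z) - h B) by ring.
apply: le_trans (ler_normD _ _) _.
by have := ler_normD (h B) (h B); rewrite /B in H2 *; lra.
Qed.

Lemma near_gt_norm z (a : R) : a < |[z]| -> \forall w \near z, a < |[w]|.
Proof.
rewrite -subr_gt0 => /(near_lt_norm z); apply: filterS => w.
by have := ler_distD w z 0; rewrite !subr0 distrC; lra.
Qed.

Lemma near_regime c z : regime c z -> \forall w \near z, regime c w.
Proof.
have N8 := cstN_gt8 K_gt1; move=> [cz zQ].
have cz' : |[c]| / N < |[z]| by rewrite ltr_pdivrMr; lra.
apply: filterS2 (near_gt_norm cz') (near_gt_norm zQ) => w; rewrite /regime.
by rewrite ltr_pdivrMr ?[|[w]| * _]mulrC => // ; lra.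
Qed.

Lemma near_stretch z (e : R) : 0 < e -> \forall w \near z, |[h w - h z]| < e.
Proof.
move=> e0; apply: (continuous_distP h z).1 e0.
apply: (@lipschitz_continuous_at _ _ _ K); near=> w.
exact: stretch_le_dist.
Unshelve. all: by end_near. Qed.

Lemma qmap_continuous c z : {for z, continuous (f c)}.
Proof.
apply: (@lipschitz_continuous_at _ _ _ (K * (2 * |[h z]| + 1))); near=> w.
have w1 : |[h w - h z]| < 1 by near: w; apply: near_stretch.
have -> : f c w - f c z = h w ^+ 2 - h z ^+ 2 by rewrite /qmap; ring.
have K1 := K_gt1; rewrite -sqr_subM mulrAC; apply: ler_pM => //.
  exact: stretch_le_dist.
have -> : h w + h z = h z + h z + (h w - h z) by ring.
apply: le_trans (ler_normD _ _) _.
by have := ler_normD (h z) (h z); lra.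
Unshelve. all: by end_near. Qed.

(** Branch cuts of the root do not enter: the increment of h(psi_(k+1)) times a sum of modulus at
    least 1 is the increment of psi_k o f_c. *)
Lemma psik_continuous k c z : regime c z -> {for z, continuous (psik k c)}.
Proof.
elim: k z => [|k IH] z cz; first exact: cvg_id.
have N8 := cstN_gt8 K_gt1; have Q8 := cstQ_gt8 K_gt1; have zQ := cz.2.
have Hf := continuous_comp (@qmap_continuous c z) (IH _ (regime_qmap theta K_gt1 cz)).
apply/continuous_distP => e e0; near=> w.
have w1 : |[h w - h z]| < 1 by near: w; apply: near_stretch.
have cw : regime c w by near: w; apply: near_regime.
have : |[psik k c (f c w) - psik k c (f c z)]| < e.
  by near: w; apply: (continuous_distP _ _).1 Hf _ e0.
apply: le_lt_trans; rewrite -!psik_sq// -sqr_subM.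
apply: (@le_trans _ _ |[h (psik k.+1 c w) - h (psik k.+1 c z)]|).
  exact: stretch_ge_dist.
apply: ler_peMr => //; rewrite addrC.
apply: le_trans (near_sum_ge K_gt1 cz (psik_bound theta K_gt1 k.+1 cz) _); first lra.
have := ler_distD (h w) (h (psik k.+1 c w)) (h z).
have := psik_bound theta K_gt1 k.+1 cw; lra.
Unshelve. all: by end_near. Qed.

Lemma bottcher_continuous c z : regime c z -> {for z, continuous (bottcher c)}.
Proof.
move=> cz; apply/continuous_distP => e e0.
have [k ke] := @expr_half_small R (8 * N) (e / 3) ltac:(lra).
have e3 : 0 < e / 3 by lra.
have psik_e := (continuous_distP _ _).1 (@psik_continuous k _ _ cz) _ e3.
near=> w.
have cw : regime c w by near: w; apply: near_regime.
have : |[psik k c w - psik k c z]| < e / 3.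
  by near: w.
have := bottcher_lim k cw; have := bottcher_lim k cz.
have := ler_distD (psik k c w) (bottcher c w) (bottcher c z).
have := ler_distD (psik k c z) (psik k c w) (bottcher c z).
rewrite [|[bottcher c w - psik k c w]|]distrC; lra.
Unshelve. all: by end_near. Qed.

(* Two points with the same image have orbits at bounded distance, which f
   would at least double at each step. *)
Lemma bottcher_inj c z w : regime c z -> regime c w ->
  bottcher c z = bottcher c w -> z = w.
Proof.
move=> cz cw zw.
suff dist k : forall z w, regime c z -> regime c w -> bottcher c z = bottcher c w ->
    |[z - w]| <= 4 * N / 2 ^+ k.
  apply/eqP; rewrite -subr_eq0 -normr_le0.
  by apply: (@le_half_eq0 _ _ (4 * N)) => k; apply: dist.
elim: k => [|k IH] {cz cw zw}z {}w cz cw zw.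
  have := bottcher_bound cz; have := bottcher_bound cw.
  have := ler_distD (h (bottcher c z)) (h z) (h w).
  have := stretch_ge theta K_gt1 (z - w).
  rewrite expr0 raddfB /= [|[h z - h (bottcher c z)]|]distrC {2}zw; lra.
have := IH _ _ (regime_qmap theta K_gt1 cz) (regime_qmap theta K_gt1 cw).
rewrite -!bottcher_sq// zw => /(_ erefl).
have -> : f c z - f c w = h z ^+ 2 - h w ^+ 2 by rewrite /qmap; ring.
rewrite -sqr_subM => H.
(* Here h z + h w = 2 h z - (h z - h w), where the difference is at most 4N and |h z| > Q. *)
have H2 : 2 <= |[h z + h w]|.
  have Q1 : 4 * N + 1 <= Q by have [] := cstQ_gt K_gt1.
  have := bottcher_bound cz; have := bottcher_bound cw; rewrite -zw.
  have := ler_distD (h (bottcher c z)) (h z) (h w).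
  have := stretch_ge theta K_gt1 z; have := cz.2.
  have Q8 := cstQ_gt8 K_gt1.
  rewrite [|[h z - h (bottcher c z)]|]distrC.
  have := ler_normD (h z + h w) (h z - h w).
  have -> : h z + h w + (h z - h w) = h z + h z by ring.
  have -> : |[h z + h z]| = 2 * |[h z]| by rewrite -mulr2n normrMn mulr_natl.
  lra.
have H3 := stretch_ge_dist theta K_gt1 z w.
have -> : 4 * N / 2 ^+ k.+1 = 4 * N / 2 ^+ k / 2 by rewrite exprS; field; rewrite expf_neq0.
have := normr_ge0 (h z - h w); nra.
Qed.

Lemma regime_exterior c z : N * Q <= |[c]| -> exterior (|[c]| / N) z -> regime c z.
Proof.
have N8 := cstN_gt8 K_gt1; rewrite /exterior /= => cNQ cz; split.
  by move: cz; rewrite ltr_pdivrMr; lra.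
by apply: le_lt_trans cz; rewrite ler_pdivlMr; lra.
Qed.

(** As |c| / N < |c|, the point c already lies in U_c. So n = 0 and nothing has to be lifted. *)
Lemma bottcher_extension_bottcher c : N * Q < |[c]| ->
  bottcher_extension K theta c (|[c]| / N) 0 (bottcher c).
Proof.
move=> cNQ; have N8 := cstN_gt8 K_gt1; have Q8 := cstQ_gt8 K_gt1.
have NQ : 0 < N * Q by apply: mulr_gt0; lra.
have reg z : exterior (|[c]| / N) z -> regime c z by apply: regime_exterior; lra.
have step z : exterior (|[c]| / N) z -> exterior (|[c]| / N) (f c z).
  move=> cz; have := qmap_regime_ge2 theta K_gt1 (reg _ cz); move: cz.
  by rewrite /exterior /=; have := normr_ge0 z; lra.
split.
- split; first by apply: divr_gt0; lra.
    by move=> _ [z cz <-]; apply: step.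
  exists (fun k => psik k c); split; last first.
    apply/uniform_cvg_distP => e e0.
    have [k ke] := @expr_half_small R (8 * N) e e0.
    near=> n => z /reg cz; rewrite distrC.
    apply: le_lt_trans (bottcher_lim n cz) _; apply: le_lt_trans ke.
    rewrite ler_wpM2l//; first lra.
    rewrite lef_pV2 ?posrE ?exprn_gt0// ler_eXn2l ?ltr1n//.
    by near: n; apply: nbhs_infty_ge.
  split=> //.
  + move=> k; apply: continuous_in_subspaceT => z /set_mem /reg cz.
    exact: psik_continuous.
  + move=> k z /reg cz; rewrite {1}/qmap addr0; exact: psik_sq.
  + move=> k P; rewrite /nbhs_simpl /= => /nbhs_ballP[e /= e0 eP].
    (* The second radius makes the bound 2|c| / |z| of [psik_near] smaller than e. *)
    exists (Num.max (|[c]| / N) (2 * |[c]| / e)) => // z.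
    rewrite /exterior /= gt_max => /andP[/reg cz ze]; apply: eP.
    rewrite -ball_normE /= sub0r normrN.
    apply: le_lt_trans (stretch_ge_dist theta K_gt1 _ _) _.
    apply: le_lt_trans (psik_near theta K_gt1 _ cz) _.
    have zQ := cz.2; move: ze; rewrite ltr_pdivrMr// [_ * e]mulrC -ltr_pdivrMr//; lra.
- split; last by [].
  by rewrite /exterior /= ltr_pdivrMr; nra.
- apply: continuous_in_subspaceT => z /set_mem /reg cz.
  exact: bottcher_continuous.
- by move=> z w /set_mem /reg cz /set_mem /reg cw; apply: bottcher_inj.
- by move=> z /reg cz; rewrite -bottcher_sq// /qmap addr0.
Unshelve. all: by end_near. Qed.

End Extension.

(** * Uniqueness of the extension *)

Section Uniqueness.
Variables (R : realType) (K theta : R).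
Hypothesis K_gt1 : 1 < K.
Local Notation C := (Rcomplex R).
Local Notation h := (stretch K theta).
Local Notation f := (qmap K theta).
Local Notation N := (cstN K).
Local Notation Q := (cstQ K).
Local Notation psik := (psik K theta).
Local Notation bottcher := (bottcher K theta).
Local Notation regime := (regime K).
Implicit Types c z w x y : C.

Lemma iter_qmap_continuous c j z : {for z, continuous (iter j (f c))}.
Proof.
elim: j z => [|j IH] z; first exact: cvg_id.
apply: (@continuous_comp _ _ _ (iter j (f c)) (f c)); first exact: IH.
exact: qmap_continuous.
Qed.

(** Each application of [qmap_open] squares the radius. *)
Lemma iter_qmap_open c j z (e : R) : 0 < e ->
  exists2 d : R, 0 < d & forall w, |[w - iter j (f c) z]| < d ->
    exists2 y, iter j (f c) y = w & |[y - z]| < e.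
Proof.
elim: j e => [|j IH] e e0; first by exists e => // w we; exists w.
have [d d0 dP] := IH e e0; exists (d ^+ 2); first exact: exprn_gt0.
move=> w wd; have [y yw yd] := qmap_open theta K_gt1 c (iter j (f c) z) w.
have [|x xy xe] := dP y.
  by rewrite -(@ltr_pXn2r _ 2) ?nnegrE ?(ltW d0)//; apply: le_lt_trans yd _.
by exists x => //=; rewrite xy.
Qed.

(** This will keep a maximum of |f_c^j| off the circle |w| = 2|c| / N. A number m bounds the inner
    orbit from above while (N/2) m bounds the outer one from below; since N = 4(K^2 + 1), this
    persists under m -> (K^2 + 1) m^2. *)
Lemma iter_qmap_norm_lt c j z w : N * Q < |[c]| -> |[c]| <= |[z]| ->
  |[w]| <= 2 * |[c]| / N -> |[iter j (f c) w]| < |[iter j (f c) z]|.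
Proof.
move=> cNQ cz wc.
have K1 := K_gt1; have N8 := cstN_gt8 K_gt1; have Q8 := cstQ_gt8 K_gt1.
have [Q1 _ _] := cstQ_gt K_gt1.
have cN : |[c]| / N * N = |[c]| by rewrite divfK// lt0r_neq0//; lra.
have cQ : Q < |[c]| / N by rewrite ltr_pdivlMr; lra.
suff [m [wm cm mz]] : exists m, [/\ |[iter j (f c) w]| <= m, |[c]| / N <= m &
     (N / 2) * m <= |[iter j (f c) z]|] by nra.
elim: j => [|j [m [wm cm mz]]] /=.
  by exists (2 * (|[c]| / N)); rewrite mulrA; split; nra.
set a := iter j _ w in wm *; set b := iter j _ z in mz *.
have ca : |[c]| <= N * m by rewrite -cN mulrC; nra.
have m0 : Q < m by lra.
exists ((K ^+ 2 + 1) * m ^+ 2); split.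
- apply: le_trans (qmap_le theta K_gt1 c a) _.
  rewrite mulrDl mul1r; apply: lerD; last first.
    by apply: le_trans ca _; rewrite expr2 ler_wpM2r//; lra.
  by rewrite ler_wpM2l ?exprn_ge0 ?lerXn2r ?nnegrE//; lra.
- have : m <= m ^+ 2 by rewrite expr2; nra.
  have : 1 <= K ^+ 2 + 1 by rewrite lerDr sqr_ge0.
  nra.
- apply: le_trans (qmap_ge theta K_gt1 c b).
  have -> : K ^+ 2 + 1 = N / 4 by rewrite /cstN; field.
  have H : (N / 2 * m) ^+ 2 <= |[b]| ^+ 2.
    by rewrite lerXn2r ?nnegrE//; apply: mulr_ge0; lra.
  have : |[c]| <= N / 8 * m ^+ 2 * N.
    apply: le_trans ca _.
    have Nm : 0 <= N * m by apply: mulr_ge0; lra.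
    have Nm1 : 0 <= N / 8 * m - 1 by rewrite subr_ge0; nra.
    have := mulr_ge0 Nm Nm1; rewrite expr2; lra.
  rewrite exprMn in H.
  have -> : N / 2 * (N / 4 * m ^+ 2) = N / 8 * m ^+ 2 * N by field.
  have E : (N / 2) ^+ 2 * m ^+ 2 = 2 * (N / 8 * m ^+ 2 * N) by field.
  rewrite E in H.
  lra.
Qed.

Lemma stretch_sqr_eq x y : h x ^+ 2 = h y ^+ 2 -> x = y \/ x = - y.
Proof.
move/eqP; rewrite eqf_sqr => /orP[/eqP /(stretch_inj K_gt1)|]; first by left.
by rewrite -raddfN => /eqP /(stretch_inj K_gt1); right.
Qed.

Lemma exterior_open (r : R) : open (exterior r : set C).
Proof. by rewrite openE => z rz; apply: near_gt_norm. Qed.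

Lemma psik_norm_gt k c z : regime c z -> 1 < |[h (psik k c z)]|.
Proof.
move=> cz; have := psik_bound theta K_gt1 k cz.
have := stretch_ge theta K_gt1 z; have := cz.2; have [Q1 _ _] := cstQ_gt K_gt1.
have := ler_distD (h (psik k c z)) (h z) 0; rewrite !subr0 distrC.
have := cstN_gt8 K_gt1; lra.
Qed.

Lemma bottcher_norm_gt c z : regime c z -> 1 < |[h (bottcher c z)]|.
Proof.
move=> cz; have := bottcher_bound theta K_gt1 cz.
have := stretch_ge theta K_gt1 z; have := cz.2; have [Q1 _ _] := cstQ_gt K_gt1.
have := ler_distD (h (bottcher c z)) (h z) 0; rewrite !subr0 distrC.
have := cstN_gt8 K_gt1; lra.
Qed.

(* Two continuous square roots that agree far out on a ray agree on the ray,
   by the intermediate value theorem for |p - q| - |p + q|. *)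
Lemma ray_sqrt_unique (p q : C -> C) z :
    (forall t : R, 1 <= t -> {for t *: z, continuous p}) ->
    (forall t : R, 1 <= t -> {for t *: z, continuous q}) ->
    (forall t : R, 1 <= t -> p (t *: z) = q (t *: z) \/ p (t *: z) = - q (t *: z)) ->
    (forall t : R, 1 <= t -> p (t *: z) != 0) ->
    (exists2 t : R, 1 <= t & p (t *: z) = q (t *: z)) ->
  p z = q z.
Proof.
move=> pc qc pq p0 [T T1 pqT].
pose g (t : R) := |[p (t *: z) - q (t *: z)]| - |[p (t *: z) + q (t *: z)]|.
have := pq 1 (lexx _); rewrite !scale1r => -[//|pqz].
have sc t : {for t, continuous (fun t : R => t *: z)}.
  exact: scalel_continuous.
have gc : {within `[1, T], continuous g}.
  apply: continuous_in_subspaceT => t /set_mem /=; rewrite in_itv /= => /andP[t1 _].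
  have pt := continuous_comp (sc t) (pc t t1).
  have qt := continuous_comp (sc t) (qc t t1).
  apply: cvgB; apply: cvg_norm; [exact: cvgB | exact: cvgD].
have [| t t1T] := IVT T1 gc (v := 0).
  rewrite /g !scale1r pqT subrr normr0 pqz addNr normr0 subr0 sub0r.
  by rewrite ge_min le_max normr_ge0 oppr_le0 normr_ge0 !orbT.
have t1 : 1 <= t by move: t1T; rewrite in_itv /= => /andP[].
have := p0 t t1; rewrite /g; have [<-|->] := pq t t1.
  rewrite subrr normr0 sub0r -mulr2n => + /eqP.
  rewrite oppr_eq0 normr_eq0 => pt; rewrite -scaler_nat scaler_eq0 (negbTE pt) orbF.
  by rewrite pnatr_eq0.
rewrite addNr normr0 subr0 -opprD normrN -mulr2n oppr_eq0 => pt /eqP.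
rewrite normr_eq0 -scaler_nat scaler_eq0 (negbTE pt) orbF.
by rewrite pnatr_eq0.
Qed.

(** By induction on k both values solve the same equation at z, so they agree up to sign. The ray
    from z outwards stays in both exteriors, and the normalisation at infinity fixes the sign far
    out on it. *)
Lemma bottcher_sequence_unique c (r : R) (q : nat -> C -> C) k z :
    N * Q < |[c]| -> f c @` exterior r `<=` exterior r ->
    bottcher_sequence K theta c (exterior r) q ->
  exterior r z -> exterior (|[c]| / N) z -> q k z = psik k c z.
Proof.
move=> cNQ fr [q0 qc qS qinf].
have reg w : exterior (|[c]| / N) w -> regime c w.
  by apply: regime_exterior => //; apply: ltW.
elim: k z => [|k IH] z rz cz; first exact: q0.
have tz_ge (t : R) : 1 <= t -> |[z]| <= |[t *: z]|.
  by move=> t1; rewrite normrZ ler_peMl// ger0_norm; lra.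
have tr (t : R) : 1 <= t -> exterior r (t *: z).
  by move=> t1; apply: lt_le_trans (tz_ge t t1).
have tc (t : R) : 1 <= t -> exterior (|[c]| / N) (t *: z).
  by move=> t1; apply: lt_le_trans (tz_ge t t1).
have sgn (t : R) : 1 <= t -> let w := t *: z in
    q k.+1 w = psik k.+1 c w \/ q k.+1 w = - psik k.+1 c w.
  move=> t1 w; have rw : exterior r w by apply: tr.
  have cw : regime c w by apply/reg/tc.
  apply: stretch_sqr_eq; rewrite psik_sq// -IH.
  - by rewrite -qS// /qmap addr0.
  - by apply: fr; exists w.
  - have := qmap_regime_ge2 theta K_gt1 cw; have := tc t t1.
    by rewrite /exterior /= -/w; have := normr_ge0 w; lra.
apply: ray_sqrt_unique => //.
- move=> t t1; have := qc k.+1; rewrite continuous_open_subspace; last exact: exterior_open.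
  by apply; apply/mem_set/tr.
- by move=> t t1; apply: psik_continuous => //; apply/reg/tc.
- move=> t t1; have p1 := psik_norm_gt k.+1 (reg _ (tc t t1)).
  have nz : psik k.+1 c (t *: z) != 0.
    by apply: contraTneq p1 => ->; rewrite raddf0 normr0 ltr10.
  by have /= [->|->] := sgn t t1; rewrite ?oppr_eq0.
- have [M _ MP] : at_infinity [set w | |[q k.+1 w - w]| < 1].
    have := qinf k => /(_ [set w | |[w]| < 1]); apply.
    by apply: filterS (near_lt_norm 0 ltr01) => w /=; rewrite subr0.
  (* Then |t z| = |z| + |M| exceeds M, beyond which q_(k+1)(w) is within 1 of w. *)
  pose t : R := 1 + `|M| / |[z]|.
  have z0 : 0 < |[z]| by have := (reg _ cz).2; have := cstQ_gt8 K_gt1; lra.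
  have t1 : 1 <= t by rewrite lerDl divr_ge0.
  exists t => //; have [//|E] := sgn t t1.
  have Mt : M < |[t *: z]|.
    rewrite normrZ ger0_norm; last by lra.
    rewrite /t mulrDl divfK ?lt0r_neq0//; have := ler_norm M; lra.
  (* With the wrong sign, psi_(k+1) would be within 2N of t z and within 1 of -t z, although 2|t z|
     > 2N + 1. *)
  exfalso; have := MP _ Mt => /=; rewrite E.
  have cw := reg _ (tc t t1); have := psik_bound theta K_gt1 k.+1 cw.
  have := stretch_ge_dist theta K_gt1 (psik k.+1 c (t *: z)) (t *: z).
  have := ler_normB (psik k.+1 c (t *: z) - t *: z) (psik k.+1 c (t *: z) + t *: z).
  rewrite (_ : - psik k.+1 c (t *: z) - t *: z = - (psik k.+1 c (t *: z) + t *: z)); last by ring.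
  rewrite normrN.
  have -> : psik k.+1 c (t *: z) - t *: z - (psik k.+1 c (t *: z) + t *: z) =
    - (t *: z + t *: z) by ring.
  have -> : |[- (t *: z + t *: z)]| = 2 * |[t *: z]| by rewrite normrN -mulr2n normrMn mulr_natl.
  have [Q1 _ _] := cstQ_gt K_gt1; have := cw.2; have := cstN_gt8 K_gt1; lra.
Qed.

Lemma bottcher_coordinate_unique c (r : R) psi z :
    N * Q < |[c]| -> bottcher_coordinate K theta c r psi ->
  exterior r z -> exterior (|[c]| / N) z -> psi z = bottcher c z.
Proof.
move=> cNQ [_ fr [q [qP /uniform_cvg_distP qpsi]]] rz cz.
have reg : regime c z by apply: regime_exterior cz => //; apply: ltW.
apply/eqP; rewrite -subr_eq0 -normr_le0; apply/ler_addgt0Pr => e e0; rewrite add0r.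
have e2 : 0 < e / 2 by lra.
have [k ke] := @expr_half_small R (8 * N) _ e2.
near \oo => n.
have : |[psi z - q n z]| < e / 2.
  have : forall y, exterior r y -> |[psi y - q n y]| < e / 2 by near: n; apply: qpsi.
  exact.
rewrite (bottcher_sequence_unique _ _ fr qP)//.
have := bottcher_lim theta K_gt1 n reg.
have : 8 * N / 2 ^+ n <= 8 * N / 2 ^+ k.
  have := cstN_gt8 K_gt1 => N8.
  rewrite ler_wpM2l//; first lra.
  rewrite lef_pV2 ?posrE ?exprn_gt0// ler_eXn2l ?ltr1n//.
  by near: n; apply: nbhs_infty_ge.
have := ler_distD (psik n c z) (psi z) (bottcher c z); lra.
Unshelve. all: by end_near. Qed.

Lemma bottcher_extension_unique c (r : R) n psi :
    N * Q < |[c]| -> bottcher_extension K theta c r n psi -> psi c = bottcher c c.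
Proof.
move=> cNQ [coord [Vc _] psic _ psiE].
have [r0 fr _] := coord.
have N8 := cstN_gt8 K_gt1; have Q8 := cstQ_gt8 K_gt1.
have [Q1 _ _] := cstQ_gt K_gt1.
have cN : |[c]| / N * N = |[c]| by rewrite divfK// lt0r_neq0//; lra.
have cQ : Q < |[c]| / N by rewrite ltr_pdivlMr; lra.
have c0 : 0 < |[c]| / N by lra.
have cN8 : 8 * (|[c]| / N) <= |[c]| by rewrite -[leRHS]cN mulrC ler_pM2l//; lra.
have reg w : exterior (|[c]| / N) w -> regime c w.
  by apply: regime_exterior => //; apply: ltW.
set V := iter n (f c) @^-1` exterior r in psic psiE.
have rV j w : (j <= n)%N -> r < |[iter j (f c) w]| -> V w.
  rewrite /V /= => jn rw; rewrite -(subnK jn); elim: (n - j)%N => [//|m IH].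
  by rewrite addSn /=; apply: fr; exists (iter (m + j) (f c) w).
have Vopen : open V.
  apply: open_comp; last exact: exterior_open.
  by move=> w _; apply: iter_qmap_continuous.
rewrite (continuous_open_subspace _ Vopen) in psic.
(* Induction on the number j of iterations that carry z into U_c; the condition |c| <= |z| passes
   from z to f_c(z). *)
suff main j z : (j <= n)%N -> |[c]| <= |[z]| -> r < |[iter j (f c) z]| -> psi z = bottcher c z.
  exact: (main n c (leqnn n) (lexx _) Vc).
elim: j z => [|j IH] z jn cz rz.
  apply: (bottcher_coordinate_unique cNQ coord) => //.
  by apply: lt_le_trans cz; lra.
have [//|bad] := eqVneq (psi z) (bottcher c z); exfalso.
(* The points with the wrong sign. The bound on the iterate keeps B inside V, and the radius 2|c| /
   N, twice that of U_c, leaves room for neighbourhoods. *)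
pose B := [set w : C | [/\ 2 * |[c]| / N <= |[w]|,
  |[iter j.+1 (f c) z]| <= |[iter j.+1 (f c) w]| & psi w != bottcher c w]].
have BW w : 2 * |[c]| / N <= |[w]| -> exterior (|[c]| / N) w.
  by rewrite /exterior /= -mulrA; lra.
have BV w : |[iter j.+1 (f c) z]| <= |[iter j.+1 (f c) w]| -> V w.
  by move=> wz; apply: (rV j.+1) => //; apply: lt_le_trans wz.
have BN w : B w -> psi w = - bottcher c w.
  move=> [w1 w2 w3]; have cw := reg _ (BW _ w1).
  have fw : psi (f c w) = bottcher c (f c w).
    apply: IH; first exact: ltnW.
      apply: le_trans (qmap_regime_ge theta K_gt1 cw); rewrite expr2; nra.
    by rewrite -iterSr; apply: lt_le_trans w2.
  case: (@stretch_sqr_eq (psi w) (bottcher c w)) => //.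
    rewrite bottcher_sq// -fw psiE; last exact: BV.
    by rewrite [in RHS]/qmap addr0.
  by move=> E; rewrite E eqxx in w3.
have Bc : B z.
  by split=> //; apply: le_trans cz; rewrite -mulrA; lra.
have contW w : exterior (|[c]| / N) w -> V w ->
    \forall y \near w, |[h (psi y) - h (psi w)]| < 1 / 2 /\
      |[h (bottcher c y) - h (bottcher c w)]| < 1 / 2.
  move=> cw Vw.
  have half0 : 0 < (1 / 2 : R) by [].
  have hc x : {for x, continuous h}.
    apply: (@lipschitz_continuous_at _ _ _ K); near=> y; exact: stretch_le_dist.
  have c1 := continuous_comp (psic w (mem_set Vw)) (hc _).
  have c2 := continuous_comp (@bottcher_continuous _ _ theta K_gt1 _ _ (reg _ cw)) (hc _).
  have d1 := (continuous_distP _ _).1 c1 _ half0.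
  have d2 := (continuous_distP _ _).1 c2 _ half0.
  by apply: filterS2 d1 d2.
(* Makes the sign locally constant: a change of sign would need a jump of 2 |h(bottcher)| > 2, but
   nearby values allow less than 1. *)
have htri x y u v : |[h x - h u]| < 1 / 2 -> |[h y - h v]| < 1 / 2 ->
    (u = v -> |[h x - h y]| < 1) /\ (u = - v -> |[h x + h y]| < 1).
  move=> xu yv; split=> uv.
    have -> : h x - h y = (h x - h u) - (h y - h v) by rewrite uv; ring.
    have := ler_normB (h x - h u) (h y - h v); lra.
  have -> : h x + h y = (h x - h u) + (h y - h v) by rewrite uv raddfN; ring.
  have := ler_normD (h x - h u) (h y - h v); lra.
have dbl x : |[h x + h x]| = 2 * |[h x]| by rewrite -mulr2n normrMn mulr_natl.
pose M := Num.max r (|[c]| / N).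
have BM w : B w -> |[w]| <= M.
  move=> [_ _ w3]; rewrite leNgt; apply: contra w3; rewrite gt_max => /andP[rw cw].
  by apply/eqP; apply: (bottcher_coordinate_unique cNQ coord).
have Bclosed : closed B.
  move=> w /= clB.
  have w1 : 2 * |[c]| / N <= |[w]|.
    rewrite leNgt -subr_gt0; apply/negP => /near_lt_norm/clB[x [[x1 _ _]] /=].
    have := ler_distD w x 0; rewrite !subr0; lra.
  have w2 : |[iter j.+1 (f c) z]| <= |[iter j.+1 (f c) w]|.
    have fc := (continuous_distP _ _).1 (@iter_qmap_continuous c j.+1 w).
    rewrite leNgt -subr_gt0; apply/negP => /fc /clB[x [[_ x2 _]]].
    have := ler_distD (iter j.+1 (f c) w) (iter j.+1 (f c) x) 0; rewrite !subr0 [_ x]/=; lra.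
  split=> //; apply/eqP => E.
  have [x [Bx [x1 x2]]] := clB _ (contW w (BW _ w1) (BV _ w2)).
  have := (htri _ _ _ _ x1 x2).1 E; rewrite (BN _ Bx) raddfN -opprD normrN dbl.
  have := bottcher_norm_gt (reg _ (BW _ (let: And3 x1 _ _ := Bx in x1))); lra.
have Bcompact : compact B by apply: Rcomplex_compact BM.
have [||w /set_mem Bw wmax] := @compact_EVT_max _ _ (fun w => |[iter j.+1 (f c) w]|) B _ Bcompact.
- by exists z.
- apply: continuous_subspaceT => w; apply: (@cvg_norm R C C (nbhs w) (nbhs_filter w)).
  exact: (@iter_qmap_continuous c j.+1 w).
have [w1 w2 w3] := Bw.
(* The maximum is not on the inner boundary, where the iterate is smaller than at z, a point of B.
   So a whole neighbourhood of w is available. *)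
have w1' : 2 * |[c]| / N < |[w]|.
  rewrite ltNge; apply/negP => wle.
  by have := iter_qmap_norm_lt j.+1 cNQ cz wle; lra.
have [e e0 eP] := near_norm_ball (filterI (near_gt_norm w1') (contW w (BW _ w1) (BV _ w2))).
have [d d0 dP] := iter_qmap_open c j.+1 w e0.
(* The point t u is at distance d/2 from u and has larger modulus. Openness gives a preimage y near
   w, which is again in B, against maximality. *)
pose u := iter j.+1 (f c) w; pose t := 1 + d / (2 * |[u]|).
have u0 : 0 < |[u]| by lra.
have t1 : 1 < t by rewrite ltrDl divr_gt0// mulr_gt0.
have [|y yu yw] := dP (t *: u).
  have -> : t *: u - u = (d / (2 * |[u]|)) *: u by rewrite /t scalerDl scale1r addrAC subrr add0r.
  rewrite normrZ ger0_norm ?divr_ge0 ?mulr_ge0 ?(ltW d0)//.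
  have -> : d / (2 * |[u]|) * |[u]| = d / 2 by field; rewrite lt0r_neq0.
  lra.
have [y1 [y2 y3]] := eP y yw.
have uy : |[u]| < |[iter j.+1 (f c) y]|.
  by rewrite yu normrZ ger0_norm ?ltr_pMl//; lra.
suff By : B y by have := wmax y (mem_set By); rewrite -/u; lra.
split; [exact: ltW | by rewrite -/u in w2; lra|].
have cy : regime c y by apply/reg/BW/ltW.
apply/eqP => E; have := (htri _ _ _ _ y2 y3).2 (BN _ Bw).
rewrite E dbl; have := bottcher_norm_gt cy; lra.
Unshelve. all: by end_near. Qed.

End Uniqueness.

(** * Differentiation in the parameter *)

Section RealDerivative.
Variable R : realType.
Local Notation C := (Rcomplex R).
Implicit Types (c v x z : C) (g L : C -> C).

(** The Frechet derivative in epsilon form, with L a bare function so that it can be built by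
    recursion; [has_deriv_diff] returns to ['d g c]. *)
Definition has_deriv g c L := linear L /\
  forall e : R, 0 < e -> \forall x \near c, |[g x - g c - L (x - c)]| <= e * |[x - c]|.

Lemma linear_scale L a v : linear L -> L (a *: v) = a *: L v.
Proof.
move=> Llin; pose L' : {linear C -> C} := HB.pack L (GRing.isLinear.Build R C C _ L Llin).
exact: (linearZ_LR L').
Qed.

Lemma linear_bounded L : linear L -> exists2 M : R, 0 < M & forall v, |[L v]| <= M * |[v]|.
Proof.
move=> Llin; pose L' : {linear C -> C} := HB.pack L (GRing.isLinear.Build R C C _ L Llin).
exists (|[L 1]| + |[L ci]| + 1); first by rewrite ltr_wpDl// addr_ge0.
move=> v; have -> : L v = complex.Re v *: L 1 + complex.Im v *: L ci.
  by rewrite {1}(ReDIm v) -[L]/(L' : _ -> _) linearD !linearZ.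
apply: le_trans (ler_normD _ _) _; rewrite !normrZ !mulrDl mul1r.
have := ler_wpM2r (normr_ge0 (L 1)) (Re_le_Rnorm v).
have := ler_wpM2r (normr_ge0 (L ci)) (Im_le_Rnorm v).
have := normr_ge0 v; rewrite ![|[v]| * _]mulrC; lra.
Qed.

Lemma has_deriv_lipschitz g c L : has_deriv g c L ->
  exists2 M : R, 0 < M & \forall x \near c, |[g x - g c]| <= M * |[x - c]|.
Proof.
move=> [/linear_bounded[M M0 LM] gL]; exists (M + 1); first by rewrite addr_gt0.
apply: filterS (gL 1 ltr01) => x; have := LM (x - c).
have := ler_distD (L (x - c)) (g x - g c) 0; rewrite !subr0; lra.
Qed.

Lemma has_deriv_continuous g c L : has_deriv g c L -> {for c, continuous g}.
Proof. by move=> /has_deriv_lipschitz[M _]; apply: lipschitz_continuous_at. Qed.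

Lemma has_deriv_id c : has_deriv id c id.
Proof.
split=> // e e0; near=> x; rewrite subrr normr0.
by rewrite mulr_ge0// ltW.
Unshelve. all: by end_near. Qed.

Lemma has_derivB g1 g2 c L1 L2 : has_deriv g1 c L1 -> has_deriv g2 c L2 ->
  has_deriv (fun x => g1 x - g2 x) c (fun v => L1 v - L2 v).
Proof.
move=> [l1 d1] [l2 d2]; split.
  by move=> a u v; rewrite l1 l2 scalerBr opprD addrACA.
move=> e e0; have e2 : 0 < e / 2 by lra.
apply: filterS2 (d1 _ e2) (d2 _ e2) => x.
have -> : g1 x - g2 x - (g1 c - g2 c) - (L1 (x - c) - L2 (x - c)) =
  (g1 x - g1 c - L1 (x - c)) - (g2 x - g2 c - L2 (x - c)) by ring.
have := ler_normB (g1 x - g1 c - L1 (x - c)) (g2 x - g2 c - L2 (x - c)); lra.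
Qed.

Lemma is_derive_dist (g : R -> R) (t l : R) :
  (forall e : R, 0 < e -> \forall s \near t, `|g s - g t - l * (s - t)| <= e * `|s - t|) ->
  is_derive t 1 g l.
Proof.
move=> gl.
have H : (fun s => s^-1 *: ((g \o shift t) (s *: 1) - g t)) @ 0^' --> l.
  apply/cvgrPdist_le => e e0.
  have /nbhs_ballP[d /= d0 dP] := gl e e0.
  near=> s.
  have s0 : s != 0 by near: s; apply: nbhs_dnbhs_neq.
  have s_gt0 : 0 < `|s| by rewrite normr_gt0.
  have := dP (s + t); rewrite -ball_normE /= opprD addrCA subrr addr0 normrN.
  have -> : `|s| < d by near: s; apply: dnbhs0_lt.
  move=> /(_ isT).
  rewrite addrK /= [s *: 1]mulr1 => H.
  rewrite distrC; have -> : s^-1 *: (g (s + t) - g t) - l = s^-1 * (g (s + t) - g t - l * s).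
    by rewrite mulrBr mulrCA mulVf// mulr1.
  by rewrite normrM normfV mulrC ler_pdivrMr.
by split; [apply/cvg_ex; exists l | apply: cvg_lim].
Unshelve. all: by end_near. Qed.

(** With w = g(c + v) - g(c), apply the real mean value theorem to t -> Re(conj(w) g(c + t v)): its
    increment on [0, 1] is |w|^2 and its derivative is at most |w| M |v|. *)
Lemma has_deriv_mean_value g (D : C -> C -> C) c v (M : R) :
  (forall t : R, 0 <= t <= 1 -> has_deriv g (c + t *: v) (D (c + t *: v))) ->
  (forall t : R, 0 <= t <= 1 -> |[D (c + t *: v) v]| <= M * |[v]|) ->
  |[g (c + v) - g c]| <= M * |[v]|.
Proof.
move=> gD DM; pose w := g (c + v) - g c.
rewrite -/w; have [->|w0] := eqVneq w 0.
  by rewrite normr0; apply: le_trans (DM 0 _); rewrite ?lexx ?ler01.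
pose p (y : C) : R := complex.Re ((conjc w : C) * y).
have pB y1 y2 : p (y1 - y2) = p y1 - p y2 by rewrite /p mulrBr raddfB.
have pZ t y : p (t *: y) = t * p y by rewrite /p; case: (conjc w) => a b; case: y => y1 y2 /=; ring.
have ple y : `|p y| <= |[w]| * |[y]|.
  by apply: le_trans (Re_le_Rnorm _) _; rewrite RnormM Rnorm_conj.
have pw : p w = |[w]| ^+ 2.
  rewrite /p; case: (w) => a b; rewrite [in RHS]/Num.norm /= sqr_sqrtr ?addr_ge0 ?sqr_ge0//.
  by rewrite mulNr opprK -!expr2.
have w_gt0 : 0 < |[w]| by rewrite normr_gt0.
pose G t := p (g (c + t *: v)); pose G' t := p (D (c + t *: v) v).
have dG (t : R) : 0 <= t <= 1 -> is_derive t 1 G (G' t).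
  move=> t01; apply: is_derive_dist => e e0.
  have [lin gd] := gD t t01.
  pose k := |[w]| * (|[v]| + 1).
  have k0 : 0 < k by rewrite mulr_gt0// ltr_wpDl.
  have ek : 0 < e / k by apply: divr_gt0.
  have [d d0 dP] := near_norm_ball (gd _ ek).
  have dv : 0 < d / (|[v]| + 1) by rewrite divr_gt0// ltr_wpDl.
  have tdv : \forall s \near t, `|t - s| < d / (|[v]| + 1).
    exact: (@cvgrPdist_lt R R R (nbhs t) _ id t).1 cvg_id _ dv.
  near=> s.
  have -> : G s - G t - G' t * (s - t) =
      p (g (c + s *: v) - g (c + t *: v) - D (c + t *: v) ((c + s *: v) - (c + t *: v))).
    have -> : c + s *: v - (c + t *: v) = (s - t) *: v.
      by rewrite opprD addrACA subrr add0r scalerBl.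
    have -> : D (c + t *: v) ((s - t) *: v) = (s - t) *: D (c + t *: v) v.
      exact: linear_scale.
    by rewrite !pB pZ /G /G' [G' t * _]mulrC.
  apply: le_trans (ple _) _.
  have svt : |[c + s *: v - (c + t *: v)]| = `|s - t| * |[v]|.
    by rewrite opprD addrACA subrr add0r -scalerBl normrZ.
  have : |[c + s *: v - (c + t *: v)]| < d.
    rewrite svt; apply: le_lt_trans (_ : `|s - t| * (|[v]| + 1) < d).
      by rewrite ler_wpM2l// lerDl.
    rewrite -ltr_pdivlMr ?ltr_wpDl// distrC.
  move=> /dP; rewrite svt => H.
  have := ler_wpM2l (ltW w_gt0) H; move/le_trans; apply.
  have -> : |[w]| * (e / k * (`|s - t| * |[v]|)) = e * `|s - t| * (|[v]| / (|[v]| + 1)).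
    by rewrite /k; field; rewrite !lt0r_neq0// ltr_wpDl.
  rewrite ler_piMr ?mulr_ge0 ?(ltW e0)// ler_pdivrMr ?ltr_wpDl//.
  by rewrite mul1r lerDl.
have cG : {within `[0, 1], continuous G}.
  apply: continuous_in_subspaceT => t /set_mem /=; rewrite in_itv /= => t01.
  by apply: differentiable_continuous; apply/derivable1_diffP; have [] := dG t t01.
have [|t t01] := @MVT_segment R G G' 0 1 ler01 _ cG.
  move=> t; rewrite in_itv /= => /andP[t0 t1]; apply: dG.
  by rewrite !ltW.
rewrite subr0 mulr1 /G scale1r scale0r addr0 -pB pw => wt.
have := DM t t01; have := ple (D (c + t *: v) v).
have H1 : |[w]| * |[w]| <= `|G' t| by rewrite -expr2 wt ler_norm.
move=> H2 H3.
rewrite -(ler_pM2l w_gt0); apply: le_trans H1 _; apply: le_trans H2 _.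
by rewrite ler_wpM2l.
Unshelve. all: by end_near. Qed.

End RealDerivative.

(** * Derivative of a geometric limit *)

Section LimitDerivative.
Variable R : realType.
Local Notation C := (Rcomplex R).
Implicit Types (c v x z : C).

(** The second bound identifies l as the limit, and the increments then give a rate independent of
    B. Below, A is proportional to |x - c| while B is not. *)
Lemma geometric_tail (u : nat -> C) (l : C) (A B : R) :
    (forall k, |[u k.+1 - u k]| <= A / 2 ^+ k) ->
    (forall k, |[u k - l]| <= B / 2 ^+ k) ->
  forall k, |[u k - l]| <= 4 * A / 2 ^+ k.
Proof.
move=> /Rcomplex_geometric_limit[l' ul'] ul k.
suff -> : l = l' by [].
apply/eqP; rewrite -subr_eq0 -normr_le0.
apply: (@le_half_eq0 _ _ (4 * A + B)) => j.
have := ul' j; have := ul j; have := ler_distD (u j) l l'.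
rewrite [|[l - u j]|]distrC mulrDl; lra.
Qed.

(** The mean value inequality for F_(k+1) - F_k makes the increments of F_k - G between c and x of
    size O(2^-k |x - c|). One index m with small tails then transfers the expansion of F_m to G. *)
Lemma has_deriv_limit (F : nat -> C -> C) (D : nat -> C -> C -> C) (G : C -> C)
    (L : C -> C) (A B : R) c (d : R) : 0 < d ->
    (forall x, |[x - c]| < d -> forall k, has_deriv (F k) x (D k x)) ->
    (forall x, |[x - c]| < d -> forall k v, |[D k.+1 x v - D k x v]| <= A / 2 ^+ k * |[v]|) ->
    (forall x, |[x - c]| < d -> forall k, |[F k x - G x]| <= B / 2 ^+ k) ->
    (forall k v, |[D k c v - L v]| <= B / 2 ^+ k * |[v]|) ->
  has_deriv G c L.
Proof.
move=> d0 FD DA FG DL.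
have cc : |[c - c]| < d by rewrite subrr normr0.
have steps x k : |[x - c]| < d ->
    |[(F k.+1 x - F k x) - (F k.+1 c - F k c)]| <= A / 2 ^+ k * |[x - c]|.
  move=> xc; have xE : x = c + (x - c) by rewrite addrC subrK.
  have near_c (t : R) : 0 <= t <= 1 -> |[c + t *: (x - c) - c]| < d.
    move=> /andP[t0 t1]; rewrite addrAC subrr add0r normrZ ger0_norm//.
    by apply: le_lt_trans xc; rewrite ler_piMl.
  rewrite [in leLHS]xE.
  apply: (@has_deriv_mean_value R (fun y => F k.+1 y - F k y)
    (fun y v => D k.+1 y v - D k y v)) => t /near_c tc; last exact: DA.
  by apply: has_derivB; apply: FD.
have tail x k : |[x - c]| < d ->
    |[(F k x - F k c) - (G x - G c)]| <= 4 * (A * |[x - c]|) / 2 ^+ k.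
  move=> xc; apply: (@geometric_tail (fun k => F k x - F k c) _ _ (B + B)) => j.
    have -> : F j.+1 x - F j.+1 c - (F j x - F j c) =
      F j.+1 x - F j x - (F j.+1 c - F j c) by ring.
    by rewrite mulrAC; apply: steps.
  have -> : F j x - F j c - (G x - G c) = (F j x - G x) - (F j c - G c) by ring.
  apply: le_trans (ler_normB _ _) _; rewrite mulrDl.
  by apply: lerD; apply: FG.
split.
  move=> a u v; apply/eqP; rewrite -subr_eq0 -normr_le0.
  apply: (@le_half_eq0 _ _ (B * |[a *: u + v]| + `|a| * (B * |[u]|) + B * |[v]|)) => k.
  have [lin _] := FD c cc k.
  have -> : L (a *: u + v) - (a *: L u + L v) = a *: (D k c u - L u) + (D k c v - L v)
      - (D k c (a *: u + v) - L (a *: u + v)).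
    by rewrite lin scalerBr; ring.
  apply: le_trans (ler_normB _ _) _; rewrite addrC -addrA mulrDl.
  apply: lerD; first by rewrite mulrAC.
  apply: le_trans (ler_normD _ _) _; rewrite mulrDl; apply: lerD.
    by rewrite normrZ -mulrA; apply: ler_wpM2l => //; rewrite mulrAC.
  by rewrite mulrAC.
move=> e e0; have e3 : 0 < e / 3 by lra.
have [m Hm Hm'] : exists2 m, 4 * `|A| / 2 ^+ m < e / 3 & `|B| / 2 ^+ m < e / 3.
  have [m] := @expr_half_small R (4 * `|A| + `|B|) (e / 3) e3; rewrite mulrDl => H.
  have p0 : 0 <= (2 ^+ m)^-1 :> R by rewrite invr_ge0 exprn_ge0.
  have := mulr_ge0 (normr_ge0 B) p0; have := mulr_ge0 (normr_ge0 A) p0.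
  by exists m; lra.
have [_ Fd] := FD c cc m.
apply: filterS2 (near_lt_norm c d0) (Fd _ e3) => x xc.
have -> : G x - G c - L (x - c) = (F m x - F m c - D m c (x - c))
   - ((F m x - F m c) - (G x - G c)) + (D m c (x - c) - L (x - c)) by ring.
move=> H1; have H2 := tail x m xc; have H3 := DL m (x - c).
apply: le_trans (ler_normD _ _) _.
have H4 := ler_normB (F m x - F m c - D m c (x - c)) ((F m x - F m c) - (G x - G c)).
have x0 := normr_ge0 (x - c).
have p0 : 0 <= (2 ^+ m)^-1 :> R by rewrite invr_ge0 exprn_ge0.
have H5 : 4 * (A * |[x - c]|) / 2 ^+ m <= e / 3 * |[x - c]|.
  have -> : 4 * (A * |[x - c]|) / 2 ^+ m = 4 * A / 2 ^+ m * |[x - c]| by ring.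
  rewrite ler_wpM2r//; apply: le_trans (ltW Hm).
  by rewrite ler_wpM2r// ler_pM2l// ler_norm.
have H6 : B / 2 ^+ m * |[x - c]| <= e / 3 * |[x - c]|.
  rewrite ler_wpM2r//; apply: le_trans (ltW Hm').
  by rewrite ler_wpM2r// ler_norm.
lra.
Qed.

End LimitDerivative.

(** * Derivatives of one forward and one backward step *)

Section Tangent.
Variables (R : realType) (K theta : R).
Hypothesis K_gt1 : 1 < K.
Local Notation C := (Rcomplex R).
Local Notation h := (stretch K theta).
Local Notation f := (qmap K theta).
Local Notation N := (cstN K).
Local Notation Q := (cstQ K).
Local Notation psik := (psik K theta).
Local Notation bottcher := (bottcher K theta).
Local Notation regime := (regime K).
Implicit Types c z w x y v zd : C.

Lemma has_deriv_qmap (g L : C -> C) c : has_deriv g c L ->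
  has_deriv (fun x => f x (g x)) c (fun v => (h (g c) * h (L v)) *+ 2 + v).
Proof.
move=> gL; have [lin gd] := gL; have [M M0 gM] := has_deriv_lipschitz gL.
have K1 := K_gt1; have K0 : 0 < K by lra.
split.
  have scaleAr (a : R) x y : x * (a *: y) = a *: (x * y).
    by rewrite mulrC -scalerAl mulrC.
  move=> a u v; rewrite lin stretchD stretchZ /= mulrDr mulrnDl [in RHS]scalerDr addrACA.
  by rewrite scaleAr scalerMnr.
move=> e e0.
pose k := 2 * |[h (g c)]| * K + 1.
have k0 : 0 < k by rewrite ltr_wpDl// !mulr_ge0// ltW.
have ek : 0 < e / (2 * k) by rewrite divr_gt0// mulr_gt0.
have eKM : 0 < e / (2 * (K * M) ^+ 2) by rewrite divr_gt0// mulr_gt0// exprn_gt0// mulr_gt0.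
near=> x.
have H1 : |[g x - g c - L (x - c)]| <= e / (2 * k) * |[x - c]| by near: x; apply: gd.
have H2 : |[g x - g c]| <= M * |[x - c]| by near: x.
have H3 : |[x - c]| < e / (2 * (K * M) ^+ 2) by near: x; apply: near_lt_norm.
have -> : f x (g x) - f c (g c) - ((h (g c) * h (L (x - c))) *+ 2 + (x - c)) =
    h (g x - g c) ^+ 2 + (h (g c) * h (g x - g c - L (x - c))) *+ 2.
  by rewrite !stretchB /qmap /=; ring.
apply: le_trans (ler_normD _ _) _; rewrite RnormX normrMn RnormM.
have -> : e * |[x - c]| = e / 2 * |[x - c]| + e / 2 * |[x - c]| by field.
have x0 := normr_ge0 (x - c).
apply: lerD.
  apply: (@le_trans _ _ ((K * M) ^+ 2 * |[x - c]| ^+ 2)).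
    rewrite -exprMn lerXn2r ?nnegrE ?mulr_ge0 ?(ltW K0) ?(ltW M0)//.
    apply: le_trans (stretch_le theta K_gt1 _) _.
    by rewrite -mulrA ler_pM2l.
  rewrite [|[x - c]| ^+ 2]expr2 mulrA ler_wpM2r// mulrC -ler_pdivlMr ?exprn_gt0 ?mulr_gt0//.
  by rewrite -mulrA -invfM; apply: ltW.
have := le_trans (stretch_le theta K_gt1 _) (ler_wpM2l (ltW K0) H1) => H4.
rewrite -[leLHS]mulr_natl.
apply: (@le_trans _ _ (2 * (|[h (g c)]| * (K * (e / (2 * k) * |[x - c]|))))).
  by rewrite ler_pM2l// ler_wpM2l.
have -> : 2 * (|[h (g c)]| * (K * (e / (2 * k) * |[x - c]|))) =
   e / 2 * |[x - c]| * ((2 * |[h (g c)]| * K) / k) by field; rewrite lt0r_neq0.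
by rewrite ler_piMr ?mulr_ge0 ?(ltW e0)// ler_pdivrMr// mul1r lerDl.
Unshelve. all: by end_near. Qed.

(** The lower bound on the sum expresses that u follows one branch. It makes h o u Lipschitz at c
    and, at x = c, the divisor nonzero; the error of linearisation is then the square of an
    increment of h o u. *)
Lemma has_deriv_sqrt (u g G : C -> C) c : has_deriv g c G ->
    (\forall x \near c, h (u x) ^+ 2 = g x /\ 1 <= |[h (u x) + h (u c)]|) ->
  has_deriv u c (fun v => stretch_inv K theta (G v / (h (u c) *+ 2))).
Proof.
move=> gG uS; have [lin gd] := gG; have [M M0 gM] := has_deriv_lipschitz gG.
have [sq0 u1] := nbhs_singleton uS.
have u0 : h (u c) *+ 2 != 0 by rewrite mulr2n -normr_gt0; apply: lt_le_trans u1.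
split.
  move=> a v w; apply: (stretch_inj K_gt1 (theta := theta)).
  by rewrite stretch_invK// stretchD stretchZ !stretch_invK// lin mulrDl -scalerAl.
move=> e e0.
have e2 : 0 < e / 2 by rewrite divr_gt0.
have eM : 0 < e / (2 * M ^+ 2) by rewrite divr_gt0// mulr_gt0// exprn_gt0.
near=> x.
have [sx x1] : h (u x) ^+ 2 = g x /\ 1 <= |[h (u x) + h (u c)]| by near: x.
have H1 : |[g x - g c - G (x - c)]| <= e / 2 * |[x - c]| by near: x; apply: gd.
have H2 : |[g x - g c]| <= M * |[x - c]| by near: x.
have H3 : |[x - c]| < e / (2 * M ^+ 2) by near: x; apply: near_lt_norm.
have x0 := normr_ge0 (x - c).
have du : |[h (u x) - h (u c)]| <= M * |[x - c]|.
  by apply: le_trans _ H2; rewrite -sx -sq0 -sqr_subM ler_peMr.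
apply: le_trans (stretch_ge theta K_gt1 _) _; rewrite !stretchB /= stretch_invK//.
have -> : h (u x) - h (u c) - G (x - c) / (h (u c) *+ 2) =
   (g x - g c - G (x - c) - (h (u x) - h (u c)) ^+ 2) / (h (u c) *+ 2).
  apply: (mulIf u0); rewrite mulrBl !divfK// -sx -sq0; ring.
rewrite RnormM RnormV; apply: le_trans (_ : _ * 1 <= _).
  apply: ler_wpM2l => //; rewrite mulr2n invf_le1//.
  by apply: lt_le_trans u1.
rewrite mulr1; apply: le_trans (ler_normB _ _) _; rewrite RnormX.
have -> : e * |[x - c]| = e / 2 * |[x - c]| + e / 2 * |[x - c]| by field.
apply: lerD => //; apply: (@le_trans _ _ ((M * |[x - c]|) ^+ 2)).
  by rewrite lerXn2r ?nnegrE ?mulr_ge0// ltW.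
rewrite exprMn [|[x - c]| ^+ 2]expr2 mulrA ler_wpM2r// mulrC -ler_pdivlMr ?exprn_gt0//.
by rewrite -mulrA -invfM; apply: ltW.
Unshelve. all: by end_near. Qed.

End Tangent.

(** * The tangent recursion and its convergence *)

Section TangentMap.
Variables (R : realType) (K theta : R).
Hypothesis K_gt1 : 1 < K.
Local Notation C := (Rcomplex R).
Local Notation h := (stretch K theta).
Local Notation f := (qmap K theta).
Local Notation N := (cstN K).
Local Notation Q := (cstQ K).
Local Notation psik := (psik K theta).
Local Notation bottcher := (bottcher K theta).
Local Notation regime := (regime K).
Implicit Types c z w x y v dz : C.

(** The differential of (c, z) -> f_c(z) in the direction (v, dz). *)
Definition dqmap z v dz : C := (h z * h dz) *+ 2 + v.

(* The derivative of psik k in the direction v of c and dz of z. *)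
Fixpoint dpsik (k : nat) c z v dz : C :=
  if k is k'.+1 then
    stretch_inv K theta (dpsik k' c (f c z) v (dqmap z v dz) / (h (psik k c z) *+ 2))
  else dz.

(** The base point is a function g of the parameter because the recursion replaces it by
    f_x(g(x)). *)
Lemma psik_has_deriv k (g L : C -> C) c :
    has_deriv g c L -> (\forall x \near c, regime x (g x)) ->
  has_deriv (fun x => psik k x (g x)) c (fun v => dpsik k c (g c) v (L v)).
Proof.
elim: k g L => [//|k IH] g L gL greg.
have fL := has_deriv_qmap theta K_gt1 gL.
have freg : \forall x \near c, regime x (f x (g x)).
  by apply: filterS greg => x; apply: regime_qmap.
apply: (has_deriv_sqrt K_gt1 (IH _ _ fL freg)).
have gcont := (continuous_distP _ _).1 (has_deriv_continuous gL).
have K1 := K_gt1; have K0 : 0 < K by lra.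
have Kv : 0 < K^-1 by rewrite invr_gt0.
have cg : regime c (g c) := nbhs_singleton greg.
apply: filterS2 greg (gcont _ Kv) => x xg gx; split; first exact: psik_sq.
have gx1 : |[h (g x) - h (g c)]| <= 1.
  apply: le_trans (stretch_le_dist theta K_gt1 _ _) _.
  by rewrite mulrC -ler_pdivlMr// mul1r ltW.
rewrite addrC; apply: le_trans (near_sum_ge K_gt1 cg (psik_bound theta K_gt1 k.+1 cg) _).
  by have := cg.2; have := cstQ_gt8 K_gt1; lra.
have := psik_bound theta K_gt1 k.+1 xg.
have := ler_distD (h (g x)) (h (psik k.+1 x (g x))) (h (g c)); lra.
Qed.

Lemma psik_ge_half k c z : regime c z -> |[z]| <= |[h (psik k c z) *+ 2]|.
Proof.
move=> cz; have := psik_bound theta K_gt1 k cz; have := stretch_ge theta K_gt1 z.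
have := cz.2; have [Q1 _ _] := cstQ_gt K_gt1; have := cstN_gt8 K_gt1.
have := ler_distD (h (psik k c z)) (h z) 0; rewrite !subr0 distrC normrMn; lra.
Qed.

Lemma dpsik_eq k c z v dz : regime c z ->
  h (dpsik k.+1 c z v dz) * (h (psik k.+1 c z) *+ 2) = dpsik k c (f c z) v (dqmap z v dz).
Proof.
move=> cz; have nz : h (psik k.+1 c z) *+ 2 != 0.
  rewrite -normr_gt0; apply: lt_le_trans (psik_ge_half k.+1 cz).
  by have := cz.2; have := cstQ_gt8 K_gt1; lra.
by rewrite stretch_invK// divfK.
Qed.

Lemma dqmap_le z v dz : |[dqmap z v dz]| <= 2 * K ^+ 2 * |[z]| * |[dz]| + |[v]|.
Proof.
apply: le_trans (ler_normD _ _) _; rewrite lerD2r normrMn RnormM.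
have := ler_pM (normr_ge0 _) (normr_ge0 _) (stretch_le theta K_gt1 z) (stretch_le theta K_gt1 dz).
rewrite mulr2n expr2; lra.
Qed.

(** Equation [E] is the recursion for the error. Its last term has the bounded coefficient
    h(psi_(k+1) z) - h z, and dividing by 2 h(psi_(k+1) z) gains |z|. *)
Lemma dpsik_near k c z v dz : regime c z ->
  |[dpsik k c z v dz - dz]| <= 8 * N * K * (|[v]| + |[dz]|) / |[z]|.
Proof.
have K1 := K_gt1; have N8 := cstN_gt8 K_gt1; have Q8 := cstQ_gt8 K_gt1.
have [Q1 _ Q3] := cstQ_gt K_gt1.
have NK : 8 < N * K by nra.
elim: k z dz => [|k IH] z dz cz.
  rewrite subrr normr0; apply: mulr_ge0; last by rewrite invr_ge0.
  by apply: mulr_ge0; [lra | rewrite addr_ge0].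
have zQ := cz.2; have z0 : 0 < |[z]| by lra.
have fz := qmap_regime_ge theta K_gt1 cz.
have f0 : 0 < |[f c z]| by apply: lt_le_trans fz; rewrite divr_gt0 ?exprn_gt0.
have d0 := normr_ge0 dz; have v0 := normr_ge0 v.
set T := dpsik k.+1 c z v dz.
have E : h (T - dz) * (h (psik k.+1 c z) *+ 2) =
   (dpsik k c (f c z) v (dqmap z v dz) - dqmap z v dz) + v
   - ((h (psik k.+1 c z) - h z) * h dz) *+ 2.
  by rewrite stretchB mulrBl dpsik_eq// /dqmap; ring.
(* The tangent vector grows by a factor of order K^2 |z|, but the denominator of the inductive bound
   becomes |f_c z| >= |z|^2 / 2. The condition 32 N K^3 <= Q is what this requires. *)
have H1 : |[dpsik k c (f c z) v (dqmap z v dz) - dqmap z v dz]| <= |[v]| + |[dz]|.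
  apply: le_trans (IH _ _ (regime_qmap theta K_gt1 cz)) _.
  rewrite ler_pdivrMr//; apply: le_trans (ler_wpM2l _ fz); last by lra.
  apply: (@le_trans _ _ (8 * N * K * (|[v]| * 2 + 2 * K ^+ 2 * |[z]| * |[dz]|))).
    by apply: ler_wpM2l; [lra | have := dqmap_le z v dz; lra].
  have zK : 32 * N * K ^+ 3 <= |[z]| by lra.
  have K13 : N * K <= N * K ^+ 3.
    by rewrite ler_pM2l; [rewrite -[leLHS]expr1 ler_eXn2l | lra].
  have zz : |[z]| <= |[z]| ^+ 2 by rewrite expr2 ler_peMl//; lra.
  have := mulr_ge0 v0 (_ : 0 <= |[z]| ^+ 2 - 32 * (N * K)).
  have := mulr_ge0 (mulr_ge0 d0 (ltW z0)) (_ : 0 <= |[z]| - 32 * N * K ^+ 3).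
  rewrite !subr_ge0 => /(_ zK) A1 /(_ _) A2.
  have {}A2 : 0 <= |[v]| * (|[z]| ^+ 2 - 32 * (N * K)) by apply: A2; lra.
  move: A1 A2; rewrite !exprS expr0; lra.
have H2 : |[T - dz]| * |[z]| <= |[v]| + |[dz]| + |[v]| + 2 * (2 * N * (K * |[dz]|)).
  apply: (@le_trans _ _ |[h (T - dz) * (h (psik k.+1 c z) *+ 2)]|).
    by rewrite RnormM ler_pM// ?stretch_ge ?psik_ge_half.
  rewrite E; apply: le_trans (ler_normB _ _) _; apply: lerD.
    by apply: le_trans (ler_normD _ _) _; rewrite lerD2r.
  rewrite normrMn RnormM -[leLHS]mulr_natl ler_pM2l// ler_pM//.
    exact: psik_bound.
  exact: stretch_le.
rewrite ler_pdivlMr//; apply: le_trans H2 _.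
have := mulr_ge0 v0 (_ : 0 <= 8 * (N * K) - 2).
have := mulr_ge0 d0 (_ : 0 <= 4 * (N * K) - 1).
rewrite !subr_ge0 => A1 A2.
have {}A1 : 0 <= |[dz]| * (4 * (N * K) - 1) by apply: A1; lra.
have {}A2 : 0 <= |[v]| * (8 * (N * K) - 2) by apply: A2; lra.
lra.
Qed.

(** The bound uses |dz| / |z| because one step multiplies this ratio by at most 4K^2, up to a term
    in |v|. Dividing by |z| > Q >= 16K^2 absorbs that factor and still leaves a gain of 1/2. *)
Lemma dpsik_step k c z v dz : regime c z ->
  |[dpsik k.+1 c z v dz - dpsik k c z v dz]|
    <= 16 * N * K / 2 ^+ k * (|[v]| + |[dz]| / |[z]|).
Proof.
have K1 := K_gt1; have N8 := cstN_gt8 K_gt1; have Q8 := cstQ_gt8 K_gt1.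
have [Q1 Q2 Q3] := cstQ_gt K_gt1.
have NK : 8 < N * K by nra.
elim: k z dz => [|k IH] z dz cz.
  rewrite expr0 divr1; apply: le_trans (dpsik_near 1 v dz cz) _.
  have zQ := cz.2; have v0 := normr_ge0 v.
  have dz0 : 0 <= |[dz]| / |[z]| by rewrite divr_ge0.
  have vz : |[v]| / |[z]| <= |[v]| by rewrite ler_piMr// invf_le1; lra.
  have -> : 8 * N * K * (|[v]| + |[dz]|) / |[z]|
    = 8 * N * K * (|[v]| / |[z]| + |[dz]| / |[z]|) by ring.
  apply: (@le_trans _ _ (8 * N * K * (|[v]| + |[dz]| / |[z]|))).
    by apply: ler_wpM2l; lra.
  by apply: ler_wpM2r; lra.
have zQ := cz.2; have z0 : 0 < |[z]| by lra.
have d0 := normr_ge0 dz; have v0 := normr_ge0 v.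
set V := dpsik k.+2 c z v dz; set W := dpsik k.+1 c z v dz.
have E : h (V - W) * (h (psik k.+2 c z) *+ 2) =
   (dpsik k.+1 c (f c z) v (dqmap z v dz) - dpsik k c (f c z) v (dqmap z v dz))
   - ((h (psik k.+2 c z) - h (psik k.+1 c z)) * h W) *+ 2.
  rewrite stretchB mulrBl -(dpsik_eq k.+1 v dz cz) -(dpsik_eq k v dz cz).
  by rewrite -/V -/W; ring.
have p0 : 0 < (2 ^+ k)^-1 :> R by rewrite invr_gt0 exprn_gt0.
have zK : 16 * K ^+ 2 <= |[z]| by lra.
have zz : |[z]| <= |[z]| ^+ 2 by rewrite expr2 ler_peMl//; lra.
have H1 : |[dpsik k.+1 c (f c z) v (dqmap z v dz) - dpsik k c (f c z) v (dqmap z v dz)]|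
    <= 16 * N * K / 2 ^+ k * (|[v]| + (4 * K ^+ 2 * |[dz]| / |[z]| + |[v]|)).
  apply: le_trans (IH _ _ (regime_qmap theta K_gt1 cz)) _.
  apply: ler_wpM2l; first by apply: mulr_ge0; lra.
  rewrite lerD2l.
  have fz := qmap_regime_ge theta K_gt1 cz.
  have z20 : 0 < |[z]| ^+ 2 / 2 by rewrite divr_gt0 ?exprn_gt0.
  rewrite ler_pdivrMr; last exact: lt_le_trans fz.
  apply: le_trans (dqmap_le z v dz) _.
  have s0 : 0 <= 4 * K ^+ 2 * |[dz]| / |[z]| + |[v]|.
    by rewrite addr_ge0// divr_ge0// mulr_ge0// mulr_ge0// exprn_ge0//; lra.
  apply: le_trans _ (ler_wpM2l s0 fz); rewrite [leRHS]mulrDl; apply: lerD.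
    by rewrite le_eqVlt; apply/orP; left; apply/eqP; field; rewrite lt0r_neq0.
  by rewrite ler_peMr//; lra.
have HW : |[W]| <= 2 * |[dz]| + |[v]|.
  have := dpsik_near k.+1 v dz cz; rewrite -/W.
  have : 8 * N * K * (|[v]| + |[dz]|) / |[z]| <= |[v]| + |[dz]|.
    rewrite ler_pdivrMr// mulrC; apply: ler_wpM2l; first lra.
    have : N * K <= N * K ^+ 3 by rewrite ler_pM2l; [rewrite -[leLHS]expr1 ler_eXn2l | lra].
    lra.
  have := ler_distD dz W 0; rewrite !subr0; lra.
have H2 : |[V - W]| * |[z]| <= 16 * N * K / 2 ^+ k * (|[v]| + (4 * K ^+ 2 * |[dz]| / |[z]| + |[v]|))
    + 2 * (2 * N / 2 ^+ k.+1 * (K * (2 * |[dz]| + |[v]|))).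
  apply: (@le_trans _ _ |[h (V - W) * (h (psik k.+2 c z) *+ 2)]|).
    by rewrite RnormM ler_pM// ?stretch_ge ?psik_ge_half.
  rewrite E; apply: le_trans (ler_normB _ _) _; apply: lerD => //.
  rewrite normrMn RnormM -[leLHS]mulr_natl ler_pM2l// ler_pM//.
    exact: psik_step.
  by apply: le_trans (stretch_le theta K_gt1 _) _; rewrite ler_pM2l//; lra.
have K4 : 4 * K ^+ 2 * |[dz]| / |[z]| <= |[dz]| / 4.
  rewrite ler_pdivrMr//; have := ler_wpM2r d0 zK; lra.
rewrite -(ler_pM2r z0); apply: le_trans H2 _.
have -> : 16 * N * K / 2 ^+ k.+1 * (|[v]| + |[dz]| / |[z]|) * |[z]| =
   (N * K) * (2 ^+ k)^-1 * (8 * |[v]| * |[z]| + 8 * |[dz]|).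
  by rewrite [2 ^+ k.+1]exprS; field; rewrite expf_neq0//= lt0r_neq0.
have -> : 16 * N * K / 2 ^+ k * (|[v]| + (4 * K ^+ 2 * |[dz]| / |[z]| + |[v]|)) +
   2 * (2 * N / 2 ^+ k.+1 * (K * (2 * |[dz]| + |[v]|))) =
   (N * K) * (2 ^+ k)^-1 * (34 * |[v]| + 16 * (4 * K ^+ 2 * |[dz]| / |[z]|) + 4 * |[dz]|).
  by rewrite [2 ^+ k.+1]exprS; field; rewrite expf_neq0//= lt0r_neq0.
apply: ler_wpM2l; first by apply: mulr_ge0; lra.
have := ler_wpM2l v0 (ltW zQ); have := ler_wpM2l v0 (ltW Q8); lra.
Qed.

Lemma regime_diag c : N * Q < |[c]| -> regime c c.
Proof.
have N8 := cstN_gt8 K_gt1; have Q8 := cstQ_gt8 K_gt1.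
have NQ : 8 * Q <= N * Q by rewrite ler_pM2r; lra.
move=> cNQ; have c0 : 0 < |[c]| by lra.
by split; [rewrite ltr_pMl; lra | lra].
Qed.

(** Both directions are v, since the point z = c moves with the parameter. *)
Definition dbottcher c v : C :=
  xget 0 [set l : C | forall k, |[dpsik k c c v v - l]| <= 128 * N * K / 2 ^+ k * |[v]|].

Lemma dpsik_diag_step k c v : N * Q < |[c]| ->
  |[dpsik k.+1 c c v v - dpsik k c c v v]| <= 32 * N * K / 2 ^+ k * |[v]|.
Proof.
move=> cNQ; have cc := regime_diag cNQ; apply: le_trans (dpsik_step k v v cc) _.
have K1 := K_gt1; have N8 := cstN_gt8 K_gt1; have Q8 := cstQ_gt8 K_gt1; have cQ := cc.2.
have -> : 32 * N * K / 2 ^+ k * |[v]| = 16 * N * K / 2 ^+ k * (|[v]| + |[v]|) by ring.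
apply: ler_wpM2l; first by rewrite divr_ge0 ?exprn_ge0//; nra.
by rewrite lerD2l ler_piMr// invf_le1; lra.
Qed.

Lemma dbottcher_lim k c v : N * Q < |[c]| ->
  |[dpsik k c c v v - dbottcher c v]| <= 128 * N * K / 2 ^+ k * |[v]|.
Proof.
move=> cNQ; move: k.
apply: (@xgetPex _ 0
  [set l : C | forall k, |[dpsik k c c v v - l]| <= 128 * N * K / 2 ^+ k * |[v]|]).
have [k|l Hl] := @Rcomplex_geometric_limit R (fun k => dpsik k c c v v) (32 * N * K * |[v]|).
  by rewrite mulrAC; apply: dpsik_diag_step.
exists l => k; apply: le_trans (Hl k) _.
by rewrite le_eqVlt; apply/orP; left; apply/eqP; ring.
Qed.

Lemma bottcher_diag_has_deriv c : N * Q < |[c]| ->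
  has_deriv (fun x => bottcher x x) c (dbottcher c).
Proof.
move=> cNQ; have [d d0 dP] := near_norm_ball (near_gt_norm cNQ).
have K1 := K_gt1; have N8 := cstN_gt8 K_gt1.
have NK : 0 <= N * K by apply: mulr_ge0; lra.
apply: (@has_deriv_limit R (fun k x => psik k x x) (fun k x v => dpsik k x x v v)
   _ _ (32 * N * K) (8 * N + 128 * N * K) c d d0) => [x xd k|x xd k v|x xd k|k v].
- apply: (@psik_has_deriv k id id x (has_deriv_id x)).
  by apply: filterS (near_gt_norm (dP x xd)) => y; apply: regime_diag.
- exact/dpsik_diag_step/dP.
- apply: le_trans (bottcher_lim theta K_gt1 k (regime_diag (dP x xd))) _.
  by rewrite ler_pM2r ?invr_gt0 ?exprn_gt0//; lra.
- apply: le_trans (dbottcher_lim k v cNQ) _; apply: ler_wpM2r => //.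
  by rewrite ler_pM2r ?invr_gt0 ?exprn_gt0//; lra.
Qed.

(** The bound [dpsik_near] at z = c with dz = v, in the limit. *)
Lemma dbottcher_near c v : N * Q < |[c]| ->
  |[dbottcher c v - v]| <= 16 * N * K / |[c]| * |[v]|.
Proof.
move=> cNQ; rewrite -subr_le0; apply: (@le_half_eq0 _ _ (128 * N * K * |[v]|)) => k.
have := dbottcher_lim k v cNQ; have := dpsik_near k v v (regime_diag cNQ).
have := ler_distD (dpsik k c c v v) (dbottcher c v) v.
rewrite [|[dbottcher c v - dpsik k c c v v]|]distrC.
have -> : 8 * N * K * (|[v]| + |[v]|) / |[c]| = 16 * N * K / |[c]| * |[v]| by ring.
rewrite [128 * N * K / _ * _]mulrAC; lra.
Qed.

End TangentMap.

Section DerivDiff.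
Variable R : realType.
Local Notation C := (Rcomplex R).
Implicit Types (c v x z : C) (g L : C -> C).

Lemma has_deriv_diff g c L : has_deriv g c L ->
  differentiable g c /\ ('d g c : C -> C) = L.
Proof.
move=> [lin gL].
pose L' : {linear C -> C} := HB.pack L (GRing.isLinear.Build R C C _ L lin).
have [M M0 LM] := linear_bounded lin.
have Lc : continuous (L' : C -> C).
  move=> x; apply: (@lipschitz_continuous_at _ _ _ M); near=> y.
  by rewrite -linearB; apply: LM.
have E : g \o shift c = cst (g c) + L' +o_ (0 : C) id.
  apply/eqaddoP => e e0.
  have [d d0 dP] := near_norm_ball (gL e e0).
  have := near_lt_norm (0 : C) d0; apply: filterS => x; rewrite subr0 => xd.
  have := dP (x + c); rewrite addrK => /(_ xd).
  by rewrite -addrA -opprD.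
have dE := diff_unique Lc E.
split; last by rewrite dE.
by apply/diff_locallyP; rewrite dE.
Unshelve. all: by end_near. Qed.
End DerivDiff.

(** * Perturbations of the identity *)

Section NearIdentity.
Variable R : realType.
Local Notation C := (Rcomplex R).
Implicit Types (c v x z w : C) (g L : C -> C).

(** Here (1 + e) / (1 - e) <= 1 + 4e precisely because e <= 1/2. *)
Lemma near_id_distortion L (e : R) : 0 <= e <= 1 / 2 ->
  (forall v, |[L v - v]| <= e * |[v]|) -> distortion L <= 1 + 4 * e.
Proof.
move=> /andP[e0 e2] Le; rewrite /distortion.
have n1 : [set z : C | `|z| = 1] (1 : C) := Rnorm1 R.
have op : opnorm L <= 1 + e.
  apply: ge_sup; first by exists |[L 1]|, 1.
  move=> _ [v v1 <-]; have := Le v; rewrite v1.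
  have := ler_distD v (L v) 0; rewrite !subr0 v1; lra.
have mi : 1 - e <= minnorm L.
  apply: lb_le_inf; first by exists |[L 1]|, 1.
  move=> _ [v v1 <-]; have := Le v; rewrite v1.
  have := ler_distD (L v) v 0; rewrite !subr0 v1 distrC; lra.
rewrite ler_pdivrMr; last by lra.
apply: le_trans op _.
have : (1 + 4 * e) * (1 - e) <= (1 + 4 * e) * minnorm L by apply: ler_wpM2l; lra.
nra.
Qed.

Lemma near_id_opnorm L (e : R) : 0 <= e -> (forall v, |[L v - v]| <= e * |[v]|) ->
  0 <= opnorm (fun v => L v - v) <= e.
Proof.
move=> e0 Le.
have n1 : [set z : C | `|z| = 1] (1 : C) := Rnorm1 R.
have ub : ubound [set `|(L v - v : C)| | v in [set z : C | `|z| = 1]] e.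
  by move=> _ [v v1 <-]; have := Le v; rewrite v1 mulr1.
apply/andP; split; last by apply: ge_sup => //; exists |[L 1 - 1]|, 1.
apply: (@le_trans _ _ |[L 1 - 1]|) => //; apply: ub_le_sup; first by exists e.
by exists 1.
Qed.

Lemma near_id_det L (e : R) : 0 <= e <= 1 / 4 ->
  (forall v, |[L v - v]| <= e * |[v]|) -> 0 < detR L.
Proof.
move=> /andP[e0 e4] Le.
have := Le 1; rewrite Rnorm1 => L1; have := Le ci; rewrite Rnorm_ci => Li.
have := le_trans (Re_le_Rnorm _) L1; have := le_trans (Im_le_Rnorm _) L1.
have := le_trans (Re_le_Rnorm _) Li; have := le_trans (Im_le_Rnorm _) Li.
rewrite !raddfB /= !subr0 !ler_norml /detR.
move: (complex.Re (L 1)) (complex.Im (L 1)) (complex.Re (L ci)) (complex.Im (L ci)).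
move=> a1 b1 a2 b2 /andP[? ?] /andP[? ?] /andP[? ?] /andP[? ?].
have : (3 / 4) * (3 / 4) <= a1 * b2 by apply: ler_pM; lra.
have : `|a2 * b1| <= (1 / 4) * (1 / 4).
  by rewrite normrM; apply: ler_pM => //; rewrite ler_norml; apply/andP; split; lra.
by rewrite ler_norml => /andP[]; lra.
Qed.

(** For the identity the two derivatives are 0 and 1; each moves by at most e, and e / (1 - e) <=
    1/2. *)
Lemma near_id_dz g c (e : R) : 0 <= e <= 1 / 4 -> differentiable g c ->
  (forall v, |[('d g c : C -> C) v - v]| <= e * |[v]|) -> |[dzbar g c]| <= 1 / 2 * |[dz g c]|.
Proof.
move=> /andP[e0 e4] gd Le; rewrite /dzbar /dz !deriveE// !normrZ.
have := Le 1; rewrite Rnorm1; have := Le ci; rewrite Rnorm_ci.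
move: (('d g c : C -> C) ci) (('d g c : C -> C) 1) => b a b1 a1.
have ii : ci * ci = -1 :> C 
  by apply/eqP; rewrite eq_complex /=; apply/andP; split; apply/eqP; ring.
have H1 : |[a + ci * b]| <= e + e.
  have -> : a + ci * b = (a - 1) + ci * (b - ci) by rewrite mulrBr ii; ring.
  by apply: le_trans (ler_normD _ _) _; rewrite RnormM Rnorm_ci mul1r lerD// -[e]mulr1.
have H2 : 2 - (e + e) <= |[a - ci * b]|.
  have E : 1 + 1 = (a - ci * b) - ((a - 1) - ci * (b - ci)) :> C by rewrite mulrBr ii; ring.
  have : |[(a - 1) - ci * (b - ci)]| <= e + e.
    by apply: le_trans (ler_normB _ _) _; rewrite RnormM Rnorm_ci mul1r lerD// -[e]mulr1.
  have := ler_normB (a - ci * b) ((a - 1) - ci * (b - ci)).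
  rewrite -E -mulr2n normrMn Rnorm1; lra.
rewrite mulrCA ler_wpM2l//; lra.
Qed.

Lemma lipschitz_absolutely_continuous (a b M : R) (g : R -> C) :
  (forall s t, a <= s -> s <= t -> t <= b -> |[g t - g s]| <= M * (t - s)) ->
  absolutely_continuous a b g.
Proof.
move=> gM e e0; exists (e / (`|M| + 1)) => [|n s t st _ d].
  by rewrite divr_gt0// ltr_wpDl.
apply: (@le_lt_trans _ _ (\sum_(i < n) (`|M| + 1) * (t i - s i))).
  apply: ler_sum => i _; have [as_ st_ tb] := st i.
  apply: le_trans (gM _ _ as_ st_ tb) _; apply: ler_wpM2r; first by rewrite subr_ge0.
  by have := ler_norm M; lra.
by rewrite -mulr_sumr mulrC -ltr_pdivlMr// ltr_wpDl.
Qed.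

(** * Maps that differ from the identity by a contraction *)

Section Homeo.
Variables (U : set C) (g : C -> C).
Hypothesis gU : forall z w, U z -> U w -> |[(g z - z) - (g w - w)]| <= 1 / 2 * |[z - w]|.

Lemma near_id_le z w : U z -> U w -> |[g z - g w]| <= 2 * |[z - w]|.
Proof.
move=> Uz Uw; have := gU Uz Uw.
have := ler_normD ((g z - z) - (g w - w)) (z - w).
have -> : (g z - z) - (g w - w) + (z - w) = g z - g w by ring.
have := normr_ge0 (z - w); lra.
Qed.

Lemma near_id_ge z w : U z -> U w -> |[z - w]| <= 2 * |[g z - g w]|.
Proof.
move=> Uz Uw; have := gU Uz Uw.
have := ler_normB (g z - g w) ((g z - z) - (g w - w)).
have -> : g z - g w - ((g z - z) - (g w - w)) = z - w by ring.
lra.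
Qed.

Lemma near_id_homeo : homeomorphism_onto_image U g.
Proof.
split.
  apply/subspace_continuousP => z Uz; apply/cvgrPdist_lt => e e0.
  have e2 : 0 < e / 2 by rewrite divr_gt0.
  near=> w; have Uw : U w by near: w; apply: withinT.
  have wz : |[w - z]| < e / 2.
    by near: w; apply: cvg_within; apply: near_lt_norm.
  by have := near_id_le Uz Uw; rewrite [|[z - w]|]distrC; lra.
pose k y : C := xget 0 [set z | U z /\ g z = y].
have kP z : U z -> k (g z) = z.
  move=> Uz; have [] := @xgetPex _ 0 [set w | U w /\ g w = g z]; first by exists z.
  rewrite -/(k _) => Uk gk; apply/eqP; rewrite -subr_eq0 -normr_le0.
  by apply: le_trans (near_id_ge Uk Uz) _; rewrite gk subrr normr0 mulr0.
exists k; split=> //.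
apply/subspace_continuousP => _ [z Uz <-]; apply/cvgrPdist_lt => e e0.
have e2 : 0 < e / 2 by rewrite divr_gt0.
near=> y; have [w Uw wy] : (g @` U) y by near: y; apply: withinT.
have yz : |[y - g z]| < e / 2.
  by near: y; apply: cvg_within; apply: near_lt_norm.
rewrite -wy; change (|[k (g z) - k (g w)]| < e); rewrite !kP//.
have := near_id_ge Uz Uw; rewrite wy [|[g z - y]|]distrC; lra.
Unshelve. all: by end_near. Qed.

(** The map is 2-Lipschitz on U, so absolute continuity holds on every line. *)
Lemma near_id_ACL : ACL U g.
Proof.
move=> a b c d ab cd abcd; split; apply: aeW => y ycd;
  apply: (@lipschitz_absolutely_continuous _ _ 2) => s t s1 st t1.
- have -> : t - s = |[(Complex t y : C) - Complex s y]|.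
    have -> : (Complex t y : C) - Complex s y = (t - s) *: (1 : C).
      by apply/eqP; rewrite eq_complex /=; apply/andP; split; apply/eqP; ring.
    by rewrite normrZ Rnorm1 mulr1 ger0_norm// subr_ge0.
  by apply: near_id_le; apply: abcd => //; apply/andP; split => //; lra.
- have -> : t - s = |[(Complex y t : C) - Complex y s]|.
    have -> : (Complex y t : C) - Complex y s = (t - s) *: ci.
      by apply/eqP; rewrite eq_complex /=; apply/andP; split; apply/eqP; ring.
    by rewrite normrZ Rnorm_ci mulr1 ger0_norm// subr_ge0.
  by apply: near_id_le; apply: abcd => //; apply/andP; split => //; lra.
Qed.

End Homeo.
End NearIdentity.

(** * The map Psi near infinity *)

Section PsiMap.
Variables (R : realType) (K theta : R).
Hypothesis K_gt1 : 1 < K.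
Local Notation C := (Rcomplex R).
Local Notation f := (qmap K theta).
Local Notation N := (cstN K).
Local Notation Q := (cstQ K).
Local Notation bottcher := (bottcher K theta).
Local Notation Psi := (Psi K theta).
Local Notation dbottcher := (dbottcher K theta).
Implicit Types c z w x y v : C.

(** Existence and uniqueness of the extension's value at c determine the choice made by [xget]. *)
Lemma Psi_bottcher c : N * Q < |[c]| -> Psi c = bottcher c c.
Proof.
move=> cNQ.
have [|r [n [psi [ext E]]]] := @xgetPex _ (0 : C)
  [set w | exists r n psi, bottcher_extension K theta c r n psi /\ w = psi c].
  exists (bottcher c c), (|[c]| / N), 0%N, (bottcher c); split=> //.
  exact: bottcher_extension_bottcher.
rewrite /Defs.Psi E.
exact: (bottcher_extension_unique K_gt1 cNQ ext).
Qed.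

(** The orbit of 0 reaches c after one step, and from there the modulus at least doubles. *)
Lemma not_Mset c : N * Q < |[c]| -> ~ Mset K theta c.
Proof.
move=> cNQ; apply; move=> P [M _ MP].
have Q8 := cstQ_gt8 K_gt1; have cc := regime_diag K_gt1 cNQ.
have grow n : regime K c (iter n (f c) c) /\ 2 ^+ n <= |[iter n (f c) c]|.
  elim: n => [|n [IH1 IH2]] /=.
    by split=> //; rewrite expr0; have := cc.2; lra.
  split; first exact: regime_qmap.
  by have := qmap_regime_ge2 theta K_gt1 IH1; rewrite exprS; lra.
have [m Mm] := @expr_half_small R M 1 ltr01.
have m0 : 0 < 2 ^+ m :> R by apply: exprn_gt0.
exists m.+1 => // n /= mn; apply: MP; rewrite /exterior /=.
case: n mn => // n mn.
have -> : iter n.+1 (f c) 0 = iter n (f c) c.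
  by rewrite iterSr /qmap raddf0 expr0n add0r.
apply: lt_le_trans (grow n).2; rewrite ltr_pdivrMr// mul1r in Mm.
by apply: lt_le_trans Mm _; rewrite ler_eXn2l ?ltr1n.
Qed.

Lemma Psi_has_deriv c : N * Q < |[c]| -> has_deriv Psi c (dbottcher c).
Proof.
move=> cNQ; have [lin bd] := bottcher_diag_has_deriv theta K_gt1 cNQ.
split=> // e e0; apply: filterS2 (near_gt_norm cNQ) (bd e e0) => x xNQ.
by rewrite !Psi_bottcher.
Qed.

Lemma dbottcher_small c : N * Q < |[c]| -> 0 <= 16 * N * K / |[c]| <= 1 / 16.
Proof.
have K1 := K_gt1; have N8 := cstN_gt8 K_gt1; have [_ _ Q3] := cstQ_gt K_gt1.
move=> cNQ; have NK : 8 < N * K by nra.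
have K13 : N * K <= N * K ^+ 3.
  by rewrite ler_pM2l; [rewrite -[leLHS]expr1 ler_eXn2l | lra].
have : 8 * Q <= N * Q by rewrite ler_pM2r; lra.
move=> NQ; have c0 : 0 < |[c]| by lra.
by apply/andP; split; [apply: divr_ge0; lra | rewrite ler_pdivrMr//; lra].
Qed.

Lemma Psi_diff c : N * Q < |[c]| -> differentiable Psi c /\
  forall v, |[('d Psi c : C -> C) v - v]| <= 16 * N * K / |[c]| * |[v]|.
Proof.
move=> cNQ; have [d dE] := has_deriv_diff (Psi_has_deriv cNQ).
by split=> // v; rewrite dE; apply: dbottcher_near.
Qed.

Lemma Psi_near_id c : N * Q < |[c]| -> |[Psi c - c]| <= 2.
Proof.
move=> cNQ; rewrite Psi_bottcher//.
have cc := regime_diag K_gt1 cNQ; have c0 : 0 < |[c]|.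
  by have := cc.2; have := cstQ_gt8 K_gt1; lra.
apply: le_trans (stretch_ge_dist theta K_gt1 _ _) _.
by apply: le_trans (bottcher_near theta K_gt1 cc) _; rewrite mulfK// lt0r_neq0.
Qed.

(* Points at distance at least 8 are handled by |Psi c - c| <= 2; closer ones
   are joined by a segment on which the derivative is close to the identity. *)
Lemma Psi_sub_id_lipschitz c x : N * Q + 8 < |[c]| -> N * Q + 8 < |[x]| ->
  |[(Psi c - c) - (Psi x - x)]| <= 1 / 2 * |[c - x]|.
Proof.
move=> cNQ xNQ.
have [far|near] := leP 8 |[c - x]|.
  have := ler_normB (Psi c - c) (Psi x - x).
  have := @Psi_near_id c; have := @Psi_near_id x; move=> /(_ _) A /(_ _) B.
  have {}A : |[Psi x - x]| <= 2 by apply: A; lra.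
  have {}B : |[Psi c - c]| <= 2 by apply: B; lra.
  lra.
have onseg (t : R) : 0 <= t <= 1 -> N * Q < |[x + t *: (c - x)]|.
  move=> /andP[t0 t1]; have := ler_distD (x + t *: (c - x)) x 0.
  rewrite !subr0 opprD addrA subrr sub0r normrN normrZ ger0_norm//.
  have : t * |[c - x]| <= |[c - x]| by rewrite ler_piMl.
  lra.
rewrite -[in leLHS](subrK x c) [c - x + x]addrC.
apply: (@has_deriv_mean_value R (fun y => Psi y - y) (fun y v => dbottcher y v - v))
  => t /onseg tNQ.
  by apply: has_derivB; [apply: Psi_has_deriv | apply: has_deriv_id].
apply: le_trans (dbottcher_near theta K_gt1 _ tNQ) _; apply: ler_wpM2r => //.
by have := dbottcher_small tNQ; lra.
Qed.

End PsiMap.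

Theorem theorem1p2 (R : realType) (K theta : R)
    (K_gt1 : 1 < K) (theta_range : - (pi / 2) < theta <= pi / 2) :
  exists rho : R,
    [/\ forall c : Rcomplex R, rho < `|c| -> ~ Mset K theta c,
        quasiconformal (exterior rho) (Psi K theta),
        forall c : Rcomplex R, rho < `|c| ->
          differentiable (Psi K theta) c /\ 0 < detR ('d (Psi K theta) c),
        exists A : R, forall c : Rcomplex R, rho < `|c| ->
          distortion ('d (Psi K theta) c) <= 1 + A * `|c|^-1 &
        opnorm (fun z : Rcomplex R => 'd (Psi K theta) c z - z)
          @[c --> at_infinity] --> (0 : R)].
Proof.
(* The margin 8 keeps segments between points at distance less than 8 inside |c| > [NQ], where the
   derivative is controlled. *)
set NQ := cstN K * cstQ K; exists (NQ + 8).
have small (c : Rcomplex R) : NQ + 8 < `|c| -> NQ < `|c| by lra.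
have e16 (e : R) : 0 <= e <= 1 / 16 -> 0 <= e <= 1 / 4 by lra.
have e12 (e : R) : 0 <= e <= 1 / 16 -> 0 <= e <= 1 / 2 by lra.
have lip z w : exterior (NQ + 8) z -> exterior (NQ + 8) w ->
  |[(Psi K theta z - z) - (Psi K theta w - w)]| <= 1 / 2 * |[z - w]|.
  exact: Psi_sub_id_lipschitz.
split.
- by move=> c /small; apply: not_Mset.
- split; [exact: near_id_homeo | exact: near_id_ACL | exists (1 / 2); first lra].
  apply: aeW => p /small cNQ; have [d dE] := Psi_diff theta K_gt1 cNQ.
  apply: And3; [exact: diff_derivable | exact: diff_derivable |].
  exact: near_id_dz (e16 _ (dbottcher_small K_gt1 cNQ)) d dE.
- move=> c /small cNQ; have [d dE] := Psi_diff theta K_gt1 cNQ; split=> //.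
  exact: near_id_det (e16 _ (dbottcher_small K_gt1 cNQ)) dE.
(* The factor 4 of [near_id_distortion] times the 16 of [dbottcher_near]. *)
- exists (64 * cstN K * K) => c /small cNQ; have [d dE] := Psi_diff theta K_gt1 cNQ.
  have := near_id_distortion (e12 _ (dbottcher_small K_gt1 cNQ)) dE.
  by move/le_trans; apply; rewrite lerD2l !mulrA -!natrM.
- apply/cvgrPdist_lt => e e0.
  exists (Num.max NQ (16 * cstN K * K / e)) => // c.
  rewrite /exterior /= gt_max => /andP[cNQ ce].
  have [d dE] := Psi_diff theta K_gt1 cNQ.
  have /andP[s0 _] := dbottcher_small K_gt1 cNQ.
  have /andP[op_ge0 op_le] := near_id_opnorm s0 dE.
  rewrite sub0r normrN ger0_norm//; apply: le_lt_trans op_le _.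
  have c0 : 0 < `|c|.
    by have := (regime_diag K_gt1 cNQ).2; have := cstQ_gt8 K_gt1; lra.
  by rewrite ltr_pdivrMr// [e * _]mulrC -ltr_pdivrMr.
Qed.
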